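(* Let $K\subset T^2\times I$ be an oriented knot projecting to an essential, simple closed curve in $T^2$, with framing parallel to $T^2\times\{0\}$. If $K$ is colored by an $n$-dimensional $\mathscr A$-module $V$, then $\Phi(K)=n$.
   Context: $I=[0,1]$, $\pi:\mathbb R^2\to T^2$ is a fixed smooth, orientation-preserving covering map with fundamental domain $I^2$ and deck transformations generated by the horizontal and vertical unit shifts. **Algebra.** $\mathscr A$ is a quasitriangular Hopf algebra over $\mathbb C$ with universal $R$-matrix $\breve R=\sum\alpha_i\otimes\beta_i\in\mathscr A\otimes\mathscr A$ and antipode $S$, and $\mu\in\mathscr A$ is a good unit, i.e. an invertible element with $\mu\alpha\mu^{-1}=S^2(\alpha)$ for all $\alpha\in\mathscr A$ and $\sum\alpha_i\mu^{-1}\beta_i=\sum\beta_i\mu\alpha_i$. Modules are finite-dimensional over $\mathbb C$; $V^*$ carries the action $(af)(x)=f(S(a)x)$. A $V$-coloring of a link (or diagram) assigns an $\mathscr A$-module to each component. **Torus diagrams.** A torus diagram $D\subset T^2$ of a smooth link $L\subset T^2\times I$ is a regular projection to $T^2\times\{0\}$, with over/under information, whose critical points are isolated. Critical points are crossings and local extrema, i.e. points with a lift to $\mathbb R^2$ that is a local maximum (cap) or local minimum (cup) of $(x,y)\mapsto y$ on $\pi^{-1}(D)$. **Local operators.** A small rectangular neighborhood $T(p)$ of a critical point $p$ is, via $\pi$, an elementary tangle diagram. An endpoint of $T(p)$ on a strand of color $V$ is assigned $V$ if the strand is oriented downward there and $V^*$ if upward; tensoring left to right over bottom (resp. top) endpoints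 gives modules $T(p)_-$ (resp. $T(p)_+$), the empty tensor product being $\mathbb C$. The operator $\mathcal F_{T(p)}:T(p)_-\to T(p)_+$ is: - for a crossing whose over-strand joins bottom left to top right, with bottom modules $X,Y$: $X\otimes Y\to Y\otimes X$, $x\otimes y\mapsto\tau(\breve R\cdot(x\otimes y))$, with $\tau$ the transposition; for the opposite crossing with bottom modules $X,Y$: the inverse of the previous map $Y\otimes X\to X\otimes Y$; - for a cap oriented left to right: $V^*\otimes V\to\mathbb C$, $f\otimes x\mapsto f(x)$; for a cap oriented right to left: $V\otimes V^*\to\mathbb C$, $x\otimes f\mapsto f(\mu x)$; - for a cup oriented left to right: $\mathbb C\to V\otimes V^*$, $1\mapsto\sum e_i\otimes e^i$; for a cup oriented right to left: $\mathbb C\to V^*\otimes V$, $1\mapsto\sum e^i\otimes\mu^{-1}e_i$. **The pseudo-operator invariant $\Phi$.** Fix a basis of each module. Let $D$ be a torus diagram, with framing parallel to $T^2\times\{0\}$, of a framed, oriented, $V$-colored link $L$, and $P$ its set of critical points. A state $\sigma$ assigns to each connected component of $D\setminus P$ of color $V$ an element of the chosen basis of $V$ if the component is oriented downward, and an element of the dual basis of $V^*$ if oriented upward. The labels below and above $p\in P$ tensor to basis elements $\sigma(p)_\mp$ of $T(p)_\mp$; the weight $\omega_p(\sigma)$ is the coefficient of $\sigma(p)_+$ in $\mathcal F_{T(p)}(\sigma(p)_-)$. Then $\Phi(L)=\Phi(D)=\sum_\sigma\prod_{p\in P}\omega_p(\sigma)$ (empty product $=1$; a component without critical points carries one label); it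 does not depend on the chosen bases or diagram. *)

(* Defs.v *)
From HB Require Import structures.
From mathcomp Require Import all_boot all_order all_algebra.
From mathcomp Require Import complex.
From mathcomp Require Import all_classical all_reals all_analysis.
Set Implicit Arguments.
Unset Strict Implicit.
Unset Printing Implicit Defensive.
Import Order.TTheory GRing.Theory Num.Theory.
Import numFieldNormedType.Exports.
Local Open Scope classical_set_scope.
Local Open Scope ring_scope.

(** An element of [A (x) A] is represented by a finite formal sum of pairs
    [(a, b)], standing for [a (x) b].  By the universal property of the tensor
    product, two formal sums represent the same element if and only if every
    bilinear map takes the same value on them; likewise for triples. *)

Definition linear_map (C : fieldType) (V W : lmodType C) (f : V -> W) :=
  forall (c : C) (x y : V), f (c *: x + y) = c *: f x + f y.

Definition tensor2_eq (C : fieldType) (A : algType C) (s t : seq (A * A)) :=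
  forall (W : lmodType C) (f : A -> A -> W),
    (forall b, linear_map (fun a => f a b)) ->
    (forall a, linear_map (f a)) ->
  \sum_(p <- s) f p.1 p.2 = \sum_(p <- t) f p.1 p.2.

Definition tensor3_eq (C : fieldType) (A : algType C)
    (s t : seq (A * A * A)) :=
  forall (W : lmodType C) (f : A -> A -> A -> W),
    (forall b c, linear_map (fun a => f a b c)) ->
    (forall a c, linear_map (fun b => f a b c)) ->
    (forall a b, linear_map (f a b)) ->
  \sum_(p <- s) f p.1.1 p.1.2 p.2 = \sum_(p <- t) f p.1.1 p.1.2 p.2.

Definition tensor2_mul (C : fieldType) (A : algType C)
    (s t : seq (A * A)) : seq (A * A) :=
  [seq (p.1 * q.1, p.2 * q.2) | p <- s, q <- t].

(** [hopf_delta a] is a choice of formal sum for the coproduct of [a], and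
    [rmat] one for the universal R-matrix. *)
Record quasitriangular_hopf (C : fieldType) (A : algType C) :=
  QuasitriangularHopf {
  hopf_delta : A -> seq (A * A);
  hopf_eps : A -> C;
  antipode : A -> A;
  rmat : seq (A * A);
  hopf_delta_linear : forall (c : C) (a b : A), tensor2_eq (hopf_delta (c *: a + b))
        ([seq (c *: p.1, p.2) | p <- hopf_delta a] ++ hopf_delta b);
  hopf_delta1 : tensor2_eq (hopf_delta 1) [:: (1, 1)];
  hopf_deltaM : forall a b : A, tensor2_eq (hopf_delta (a * b))
        (tensor2_mul (hopf_delta a) (hopf_delta b));
  hopf_eps_linear : forall (c : C) (a b : A),
        hopf_eps (c *: a + b) = c * hopf_eps a + hopf_eps b;
  hopf_eps1 : hopf_eps 1 = 1;
  hopf_epsM : forall a b : A, hopf_eps (a * b) = hopf_eps a * hopf_eps b;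
  hopf_coassoc : forall a : A, tensor3_eq
        [seq (q.1, q.2, p.2) | p <- hopf_delta a, q <- hopf_delta p.1]
        [seq (p.1, q.1, q.2) | p <- hopf_delta a, q <- hopf_delta p.2];
  hopf_counitl : forall a : A, \sum_(p <- hopf_delta a) hopf_eps p.1 *: p.2 = a;
  hopf_counitr : forall a : A, \sum_(p <- hopf_delta a) hopf_eps p.2 *: p.1 = a;
  antipode_linear : linear_map antipode;
  antipode_mull : forall a : A,
        \sum_(p <- hopf_delta a) antipode p.1 * p.2 = (hopf_eps a)%:A;
  antipode_mulr : forall a : A,
        \sum_(p <- hopf_delta a) p.1 * antipode p.2 = (hopf_eps a)%:A;
  rmat_invertible : exists rinv : seq (A * A),
        tensor2_eq (tensor2_mul rmat rinv) [:: (1, 1)] /\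
        tensor2_eq (tensor2_mul rinv rmat) [:: (1, 1)];
  rmat_intertwine : forall a : A, tensor2_eq
        (tensor2_mul [seq (p.2, p.1) | p <- hopf_delta a] rmat)
        (tensor2_mul rmat (hopf_delta a));
  (* (Delta (x) id) R = R13 R23 *)
  rmat_delta_left : tensor3_eq
        [seq (q.1, q.2, p.2) | p <- rmat, q <- hopf_delta p.1]
        [seq (p.1, q.1, p.2 * q.2) | p <- rmat, q <- rmat];
  (* (id (x) Delta) R = R13 R12 *)
  rmat_delta_right : tensor3_eq
        [seq (p.1, q.1, q.2) | p <- rmat, q <- hopf_delta p.2]
        [seq (p.1 * q.1, q.2, p.2) | p <- rmat, q <- rmat]
}.

(** [algType] carries no inverse, so the inverse of [mu] is explicit data
    (unique when it exists). *)
Record good_unit (C : fieldType) (A : algType C) (H : quasitriangular_hopf A)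
    (mu muV : A) : Prop := GoodUnit {
  good_unit_mulV : mu * muV = 1;
  good_unit_Vmul : muV * mu = 1;
  good_unit_conj : forall a : A, mu * a * muV = antipode H (antipode H a);
  good_unit_rmat : \sum_(p <- rmat H) p.1 * muV * p.2 =
                   \sum_(p <- rmat H) p.2 * mu * p.1
}.

Record based_module (C : fieldType) (A : algType C) := BasedModule {
  mcarrier : vectType C;
  mact : A -> 'End(mcarrier);
  msize : nat;
  mbasis : msize.-tuple mcarrier
}.

Record is_module (C : fieldType) (A : algType C) (V : based_module A) : Prop :=
  IsModule {
  mact_linear : forall (c : C) (a b : A),
    mact V (c *: a + b) = c *: mact V a + mact V b;
  mact1 : forall x, mact V 1 x = x;
  mactM : forall (a b : A) x, mact V (a * b) x = mact V a (mact V b x);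
  mbasisP : basis_of fullv (mbasis V)
}.

(** [V^*] with [(a f)(x) = f (S(a) x)] and the dual basis. *)
Definition dual_module (C : fieldType) (A : algType C)
    (H : quasitriangular_hopf A) (V : based_module A) : based_module A :=
  @BasedModule C A 'Hom(mcarrier V, C^o)
    (fun a => linfun (fun f : 'Hom(mcarrier V, C^o) =>
                        (f \o mact V (antipode H a))%VF))
    (msize V)
    [tuple linfun (fun x : mcarrier V => (coord (mbasis V) i x : C^o))
       | i < msize V].

Definition endpoint_module (C : fieldType) (A : algType C)
    (H : quasitriangular_hopf A) (V : based_module A) (up : bool) :=
  if up then dual_module H V else V.

(** [X (x) Y] is realized as the space of matrices of coefficients in the
    tensor product of the chosen bases; entry [(k, l)] is the coefficient of
    the tensor of the [k]-th basis vector of [X] and the [l]-th of [Y]. *)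
Definition tens (C : fieldType) (A : algType C) (X Y : based_module A)
    (x : mcarrier X) (y : mcarrier Y) : 'M[C]_(msize X, msize Y) :=
  \matrix_(k, l) (coord (mbasis X) k x * coord (mbasis Y) l y).

(** [x (x) y |-> tau (R (x (x) y))]. *)
Definition braiding (C : fieldType) (A : algType C)
    (H : quasitriangular_hopf A) (X Y : based_module A) :
    'Hom('M[C]_(msize X, msize Y), 'M[C]_(msize Y, msize X)) :=
  linfun (fun M : 'M[C]_(msize X, msize Y) =>
    \sum_k \sum_l M k l *: \sum_(p <- rmat H)
      tens (mact Y p.2 (tnth (mbasis Y) l)) (mact X p.1 (tnth (mbasis X) k))).

(** [pi] exhibits [T] as the quotient of the plane by the unit shifts.  The
    smooth structure and the orientation of the torus are those transported
    from the plane by [pi]. *)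
Record torus_covering (R : realType) (T : topologicalType) (pi : R * R -> T) :
    Prop := TorusCovering {
  torus_continuous : continuous pi;
  torus_open : forall U : set (R * R), open U -> open (pi @` U);
  torus_surj : forall p : T, exists q, pi q = p;
  torus_fibre : forall q q' : R * R, pi q = pi q' <->
    exists a b : int, q' = (q.1 + a%:~R, q.2 + b%:~R)
}.

Definition same_time (R : realType) (s t : R) := exists k : int, t = s + k%:~R.

Definition loop_nullhomotopic (R : realType) (T : topologicalType)
    (c : R -> T) :=
  exists h : R * R -> T,
    [/\ continuous h,
        forall t s, h (t + 1, s) = h (t, s),
        forall t, h (t, 0) = c t &
        exists p, forall t, h (t, 1) = p].

Definition essential_simple_closed (R : realType) (T : topologicalType)
    (c : R -> T) :=
  [/\ continuous c,
      forall t, c (t + 1) = c t,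
      forall s t, c s = c t -> same_time s t &
      ~ loop_nullhomotopic c].

Definition smooth (R : realType) (f : R -> R) :=
  forall n t, derivable (derive1n n f) t 1.

(** Each component is given by a smooth 1-periodic parametrization
    [t |-> (pi (lx i t, ly i t), lz i t)], hence by a smooth lift [(lx, ly)] of
    its projection and its height [lz]; the orientation is that of increasing
    [t].  The framing is the vector field [(fx, fy, fz)] along it, in the
    coordinates provided by [pi]. *)
Record framed_link (R : realType) (T : topologicalType) (pi : R * R -> T)
    (m : nat) := FramedLink {
  lx : 'I_m -> R -> R;
  ly : 'I_m -> R -> R;
  lz : 'I_m -> R -> R;
  fx : 'I_m -> R -> R;
  fy : 'I_m -> R -> R;
  fz : 'I_m -> R -> R;
  link_smooth : forall i, [/\ smooth (lx i), smooth (ly i) & smooth (lz i)];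
  framing_smooth : forall i, [/\ smooth (fx i), smooth (fy i) & smooth (fz i)];
  link_closed : forall i t, pi (lx i (t + 1), ly i (t + 1)) = pi (lx i t, ly i t);
  height_closed : forall i t, lz i (t + 1) = lz i t;
  height_unit : forall i t, 0 <= lz i t <= 1;
  framing_closed : forall i t,
        [/\ fx i (t + 1) = fx i t, fy i (t + 1) = fy i t &
            fz i (t + 1) = fz i t];
  link_injective : forall i j s t,
        pi (lx i s, ly i s) = pi (lx j t, ly j t) -> lz i s = lz j t ->
        i = j /\ same_time s t;
  tangent_framing_independent : forall i t (a b : R),
        a * derive1 (lx i) t + b * fx i t = 0 ->
        a * derive1 (ly i) t + b * fy i t = 0 ->
        a * derive1 (lz i) t + b * fz i t = 0 ->
        a = 0 /\ b = 0
}.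

Section Diagram.
Context (R : realType) (T : topologicalType) (pi : R * R -> T) (m : nat).
Implicit Types (L : framed_link pi m) (i j : 'I_m) (s t : R) (p : T).

Definition shadow L i t : T := pi (lx L i t, ly L i t).

Definition diagram_set L : set T := [set p | exists i t, shadow L i t = p].

Definition plane_det (u v : R * R) : R := u.1 * v.2 - u.2 * v.1.

Definition velocity L i t : R * R := (derive1 (lx L i) t, derive1 (ly L i) t).

(** Two framings that are horizontal and nowhere tangent to the projection are
    homotopic, so this determines the framing of a link with a diagram; if
    tangency of the projections were allowed, the framing could twist wherever
    the height varies. *)
Definition parallel_framing L := forall i t,
  fz L i t = 0 /\ plane_det (velocity L i t) (fx L i t, fy L i t) != 0.

Definition is_crossing L p := exists i s j t,
  [/\ shadow L i s = p, shadow L j t = p & ~ (i = j /\ same_time s t)].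

Definition is_cap L p := diagram_set L p /\ exists q : R * R, pi q = p /\
  \forall q' \near q, diagram_set L (pi q') -> q'.2 <= q.2.

Definition is_cup L p := diagram_set L p /\ exists q : R * R, pi q = p /\
  \forall q' \near q, diagram_set L (pi q') -> q.2 <= q'.2.

Definition critical L : set T :=
  [set p | [\/ is_crossing L p, is_cap L p | is_cup L p]].

(** Regularity of the projection: an immersion whose multiple points are
    transverse double points, at which no strand turns vertically, so that a
    neighborhood of a crossing is an elementary tangle.  The critical points
    are isolated in the torus, hence finite in number by compactness. *)
Record torus_diagram L : Prop := TorusDiagram {
  diagram_immersed : forall i t, velocity L i t <> (0, 0);
  diagram_transverse : forall i s j t, shadow L i s = shadow L j t ->
    ~ (i = j /\ same_time s t) ->
    plane_det (velocity L i s) (velocity L j t) != 0;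
  diagram_double : forall i s j t k u,
    shadow L i s = shadow L j t -> shadow L i s = shadow L k u ->
    [\/ i = j /\ same_time s t, i = k /\ same_time s u |
        j = k /\ same_time t u];
  diagram_crossing_no_extremum : forall i s, is_crossing L (shadow L i s) ->
    ~ (\forall u \near s, ly L i u <= ly L i s) /\
    ~ (\forall u \near s, ly L i s <= ly L i u);
  diagram_isolated : forall p, \forall q \near p^', ~ critical L q
}.

(** [D] is a torus diagram of [L], drawn on the projection of [L] up to an
    ambient isotopy [phi] of the torus.  The isotopy is needed when the
    critical points of the projection of [L] itself are not isolated, as for a
    horizontal circle; when they are, it may be taken constant.  (Continuous
    bijections of the compact Hausdorff space [T] are homeomorphisms.) *)
Definition torus_diagram_of L D :=
  torus_diagram D /\ exists phi : R * T -> T,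
    [/\ continuous phi,
        forall s, 0 <= s <= 1 -> bijective (fun p => phi (s, p)),
        forall p, phi (0, p) = p &
        forall i t, shadow D i t = phi (1, shadow L i t) /\
                    lz D i t = lz L i t].

(** [D \ P] has finitely many connected components; they are identified with
    the subsets of [T] they form. *)
Definition arc_of L i (B : set T) := exists t,
  ~ critical L (shadow L i t) /\
  B = connected_component (diagram_set L `\` critical L) (shadow L i t).

Definition upward L i t := `[< \forall u \near t^'+, ly L i t < ly L i u >].

Definition upward_velocity L i t : R * R :=
  if upward L i t then velocity L i t
  else (- derive1 (lx L i) t, - derive1 (ly L i) t).

Definition label_before L (sigma : set T -> nat) i t (k : nat) := exists B,
  [/\ arc_of L i B, \forall u \near t^'-, B (shadow L i u) & sigma B = k].

Definition label_after L (sigma : set T -> nat) i t (k : nat) := exists B,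
  [/\ arc_of L i B, \forall u \near t^'+, B (shadow L i u) & sigma B = k].

Definition label_below L sigma i t k :=
  if upward L i t then label_before L sigma i t k
  else label_after L sigma i t k.

Definition label_above L sigma i t k :=
  if upward L i t then label_after L sigma i t k
  else label_before L sigma i t k.

End Diagram.

Section PseudoOperator.
Context (R : realType) (T : topologicalType) (pi : R * R -> T) (m : nat).
Context (C : fieldType) (A : algType C) (H : quasitriangular_hopf A).
Context (mu muV : A).
Implicit Types (D : framed_link pi m) (V : 'I_m -> based_module A).

Local Notation bas V := (tnth (mbasis V)).
Local Notation dbas V :=
  (fun k => tnth (mbasis (dual_module H V)) k : 'Hom(mcarrier V, C^o)).

(** A state assigns to an arc of color [V] the index of an element of the basis
    of [V] (or of the dual basis of [V^*], according to the direction).  It is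
    recorded as a function on sets vanishing outside the arcs. *)
Definition states D V : set (set T -> nat) :=
  [set sigma | (forall i B, arc_of D i B -> (sigma B < msize (V i))%N) /\
               (forall B, (forall i, ~ arc_of D i B) -> sigma B = 0%N)].

(** [weight_at D V sigma p w]: the coefficient of [sigma(p)_+] in the image of
    [sigma(p)_-] under the local operator of [p] is [w].  A strand through a
    cap or cup is oriented left to right when the velocity there, which is
    horizontal, points to the right.  At a crossing, [O] and [U] are the
    modules of the lower endpoints of the over- and under-strand; the
    over-strand joins bottom left to top right exactly when the upward
    velocities of the over- and under-strand form a positive basis. *)
Inductive weight_at D V (sigma : set T -> nat) (p : T) : C -> Prop :=
| Weight_cap_lr i t (k l : 'I_(msize (V i))) of
    is_cap D p & shadow D i t = p & 0 < derive1 (lx D i) t &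
    label_before D sigma i t k & label_after D sigma i t l :
    weight_at D V sigma p (dbas (V i) k (bas (V i) l))
| Weight_cap_rl i t (k l : 'I_(msize (V i))) of
    is_cap D p & shadow D i t = p & derive1 (lx D i) t < 0 &
    label_before D sigma i t k & label_after D sigma i t l :
    weight_at D V sigma p (dbas (V i) k (mact (V i) mu (bas (V i) l)))
| Weight_cup_lr i t (k l : 'I_(msize (V i))) of
    is_cup D p & shadow D i t = p & 0 < derive1 (lx D i) t &
    label_before D sigma i t k & label_after D sigma i t l :
    weight_at D V sigma p
      ((\sum_e @tens C A (V i) (dual_module H (V i))
                 (bas (V i) e) (dbas (V i) e)) k l)
| Weight_cup_rl i t (k l : 'I_(msize (V i))) of
    is_cup D p & shadow D i t = p & derive1 (lx D i) t < 0 &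
    label_before D sigma i t k & label_after D sigma i t l :
    weight_at D V sigma p
      ((\sum_e @tens C A (dual_module H (V i)) (V i)
                 (dbas (V i) e) (mact (V i) muV (bas (V i) e))) l k)
| Weight_crossing_over_right i s j t
    (O := endpoint_module H (V i) (upward D i s))
    (U := endpoint_module H (V j) (upward D j t))
    (k k' : 'I_(msize O)) (l l' : 'I_(msize U)) of
    shadow D i s = p & shadow D j t = p & lz D j t < lz D i s &
    0 < plane_det (upward_velocity D i s) (upward_velocity D j t) &
    label_below D sigma i s k & label_above D sigma i s k' &
    label_below D sigma j t l & label_above D sigma j t l' :
    weight_at D V sigma p
      (braiding H O U (tens (bas O k) (bas U l)) l' k')
| Weight_crossing_over_left i s j t
    (O := endpoint_module H (V i) (upward D i s))
    (U := endpoint_module H (V j) (upward D j t))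
    (k k' : 'I_(msize O)) (l l' : 'I_(msize U)) of
    shadow D i s = p & shadow D j t = p & lz D j t < lz D i s &
    plane_det (upward_velocity D i s) (upward_velocity D j t) < 0 &
    label_below D sigma i s k & label_above D sigma i s k' &
    label_below D sigma j t l & label_above D sigma j t l' :
    weight_at D V sigma p
      ((braiding H O U)^-1%VF (tens (bas U l) (bas O k)) k' l').

(** For a state of a torus diagram and a critical point there is exactly one
    such coefficient. *)
Definition weight D V sigma p : C := xget 0 [set w | weight_at D V sigma p w].

Definition Phi D V : C :=
  \sum_(sigma \in states D V)
    \big[*%R/1]_(p \in critical D) weight D V sigma p.

End PseudoOperator.

(* Main.v *)
Require Import Defs.
From HB Require Import structures.
From mathcomp Require Import all_boot all_order all_algebra.
From mathcomp Require Import complex.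
From mathcomp Require Import all_classical all_reals all_analysis.
From mathcomp Require Import zify ring lra.
Set Implicit Arguments.
Unset Strict Implicit.
Unset Printing Implicit Defensive.
Import Order.TTheory GRing.Theory Num.Theory.
Import numFieldNormedType.Exports.
Local Open Scope classical_set_scope.
Local Open Scope ring_scope.

(** Along a simple closed diagram there are no crossings, so [Phi] sums, over
    labellings of the arcs in cyclic order, the product of the matrix entries
    of the local operators at the caps and cups: it is the trace of the product
    of these matrices around the curve.  The matrix is the identity at an
    extremum oriented left to right, the action of [mu] at a cap oriented right
    to left, and the action of the inverse of [mu] at a cup oriented right to
    left.  Hence the product is a power of the action of [mu], whose exponent
    is the number of right-to-left caps minus the number of right-to-left cups;
    this is the rotation number of the velocity, and the trace is [n] as soon
    as it vanishes.

    It vanishes because the curve is essential.  A lift of the curve to the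
    plane satisfies [gamma (t + 1) = gamma t + (a, b)], where [(a, b)] is not
    zero, for otherwise contracting the lift linearly to the origin would
    contract the knot.  As the curve is simple, the secant
    [gamma (t + h) - gamma t] never vanishes for [h > 0]; it is 1-periodic in
    [t], is the constant [(a, b)] for [h = 1], and points nearly in the
    direction of the velocity for small [h].  Deforming [h] from 1 towards 0
    therefore shows that the velocity has a continuous polar angle [th] that is
    itself 1-periodic ([velocity_has_periodic_angle]).

    The angle turns the count into a telescoping product.  Between consecutive
    critical points the height function is strictly monotone, so [th] stays in
    one strip [[2 pi e - pi, 2 pi e + pi]].  At a right-to-left cap [e]
    increases by 1, at a right-to-left cup it decreases by 1, and at the other
    extrema it does not change ([turn_at_max], [turn_at_min]).  Thus each local
    matrix has the form [Q_e^-1 Q_e'], where [Q_e] is the action of the [e]-th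
    power of [mu], and since [th] is periodic the product around the curve is
    the identity.

    Two facts connect this with the state sum.  The connected components of the
    diagram minus its critical points are the images of the time intervals
    between consecutive critical times ([arc_component]): the torus is
    Hausdorff, so images of compact time intervals are closed.  And caps and
    cups, which are defined through the diagram near a point of the plane,
    occur exactly at the local extrema of the height along the parametrization
    ([cap_local_max], [cup_local_min]), since a simple curve does not come back
    close to one of its points. *)

(** * Periodic predicates on the line *)

Lemma periodic_int (R : realType) (Q : R -> Prop) :
  (forall t, Q (t + 1) <-> Q t) -> forall (n : int) t, Q (t + n%:~R) <-> Q t.
Proof.
move=> HQ.
have Hn (n : nat) t : Q (t + n%:R) <-> Q t.
  elim: n => [|n IH]; first by rewrite addr0.
  by rewrite -natr1 addrA HQ.
case=> n t; first exact: Hn.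
by rewrite NegzE mulrNz -[X in _ <-> Q X](subrK n.+1%:R) Hn.
Qed.

Lemma periodic_unit_interval (R : realType) (Q : R -> Prop) :
  (forall t, Q (t + 1) <-> Q t) -> (forall t, 0 <= t <= 1 -> Q t) ->
  forall t, Q t.
Proof.
move=> HQ H t; rewrite -[t](subrK (Num.floor t)%:~R) periodic_int //.
apply: H; have := floor_le_tmp t; have := ltW (floorD1_gt t).
by rewrite intrD; lra.
Qed.

(** Periodicity reduces the time to a compact interval, so a property that
    holds locally in time holds uniformly in time. *)
Lemma near_uniformly_periodic (R : realType) (I : Type) (F : set_system I)
    (P : I -> R -> Prop) {FF : Filter F} :
  (forall i t, P i (t + 1) <-> P i t) ->
  (forall t : R, \forall t' \near t & i \near F, P i t') ->
  \forall i \near F, forall t, P i t.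
Proof.
move=> PP H.
have /compact_near_coveringP K01 := @segment_compact R 0 1.
apply: filterS (K01 I F P FF (fun t _ => H t)) => i Hi.
by apply: periodic_unit_interval => // t t01; apply: Hi; rewrite /= in_itv.
Qed.

Lemma near_one_sided (R : realType) (u : R) (P : R -> Prop) :
  (\forall v \near u, P v) ->
  (\forall v \near u^'-, P v) /\ (\forall v \near u^'+, P v).
Proof. by move=> H; split; rewrite near_withinE; apply: filterS H. Qed.

Lemma eq0_of_norm_lt1 (R : realType) (n : int) : `|n%:~R : R| < 1 -> n = 0.
Proof. by rewrite -intr_norm ltrz1 => ?; lia. Qed.

(** * The angle of the velocity *)

(** A plane vector field along the circle has rotation number zero exactly
    when its polar angle can be chosen continuous and 1-periodic; this avoids
    any discussion of winding numbers. *)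
Definition has_periodic_angle (R : realType) (v w : R -> R) :=
  exists2 th : R -> R, continuous th &
    (forall t, th (t + 1) = th t) /\
    forall t, exists2 r, 0 < r & v t = r * cos (th t) /\ w t = r * sin (th t).

(** The rotation number is a homotopy invariant.  If [v] makes everywhere an
    acute angle with [u], the angle from [u] to [v] is the arctangent of a
    continuous periodic function, to be added to the angle of [u]. *)
Lemma has_periodic_angle_step (R : realType) (u1 u2 v1 v2 : R -> R) :
  has_periodic_angle u1 u2 -> continuous v1 -> continuous v2 ->
  (forall t, v1 (t + 1) = v1 t) -> (forall t, v2 (t + 1) = v2 t) ->
  (forall t, 0 < u1 t * v1 t + u2 t * v2 t) ->
  has_periodic_angle v1 v2.
Proof.
move=> [th cth [pth ath]] cv1 cv2 pv1 pv2 uv.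
(* [(d, e)] are the coordinates of [v] in the frame rotated by [th]. *)
pose d t := cos (th t) * v1 t + sin (th t) * v2 t.
pose e t := cos (th t) * v2 t - sin (th t) * v1 t.
have dgt0 t : 0 < d t.
  have [r r0 [e1 e2]] := ath t.
  by rewrite -(pmulr_rgt0 _ r0) /d mulrDr !mulrA -e1 -e2.
have cc t : cos (th x) @[x --> t] --> cos (th t).
  by apply: continuous_comp; [exact: cth|exact: continuous_cos].
have cs t : sin (th x) @[x --> t] --> sin (th t).
  by apply: continuous_comp; [exact: cth|exact: continuous_sin].
have cd : continuous d.
  by move=> t; apply: cvgD; apply: cvgM;
    [exact: cc|exact: cv1|exact: cs|exact: cv2].
have ce : continuous e.
  by move=> t; apply: cvgB; apply: cvgM;
    [exact: cc|exact: cv2|exact: cs|exact: cv1].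
exists (fun t => th t + atan (e t / d t)).
  move=> t; apply: cvgD; first exact: cth.
  apply: (@continuous_comp _ _ _ (fun t => e t / d t) atan).
    apply: cvgM; first exact: ce.
    by apply: cvgV; [rewrite gt_eqF|exact: cd].
  exact: continuous_atan.
split=> [t|t]; first by rewrite /e /d pth pv1 pv2.
have dn0 : d t != 0 by rewrite gt_eqF.
set z := e t / d t.
have n0 : 0 < 1 + z ^+ 2 by rewrite ltr_pwDl // sqr_ge0.
have n1 : 0 < Num.sqrt (1 + z ^+ 2) by rewrite sqrtr_gt0.
have sa : sin (atan z) = z * cos (atan z).
  have : cos (atan z) != 0 by rewrite cos_atan invr_neq0 // gt_eqF.
  by move=> c0; rewrite -[X in X * _](atanK z) /tan divfK.
have cds := cos2Dsin2 (th t).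
exists (Num.sqrt (1 + z ^+ 2) * d t); first by rewrite mulr_gt0.
rewrite cosD sinD sa cos_atan.
set q := Num.sqrt _ in n1 *.
have q0 : q != 0 by rewrite gt_eqF.
have zE : d t * z = e t by rewrite /z mulrC divfK.
split.
  have -> : q * d t * (cos (th t) * q^-1 - sin (th t) * (z * q^-1)) =
      (q / q) * (d t * cos (th t) - sin (th t) * (d t * z)) by ring.
  rewrite divff // mul1r zE /d /e.
  transitivity ((cos (th t) ^+ 2 + sin (th t) ^+ 2) * v1 t); last by ring.
  by rewrite cds mul1r.
have -> : q * d t * (sin (th t) * q^-1 + cos (th t) * (z * q^-1)) =
    (q / q) * (d t * sin (th t) + cos (th t) * (d t * z)) by ring.
rewrite divff // mul1r zE /d /e.
transitivity ((cos (th t) ^+ 2 + sin (th t) ^+ 2) * v2 t); last by ring.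
by rewrite cds mul1r.
Qed.

Lemma has_periodic_angle_cst (R : realType) (a b : R) : (a, b) <> (0, 0) ->
  has_periodic_angle (fun=> a) (fun=> b).
Proof.
move=> ab.
(* One of the four unit vectors along the axes makes an acute angle with
   [(a, b)]. *)
have H (th : R) : 0 < cos th * a + sin th * b ->
    has_periodic_angle (fun=> a) (fun=> b).
  move=> p.
  apply: (@has_periodic_angle_step _ (fun=> cos th) (fun=> sin th)) => //;
    try exact: cst_continuous.
  exists (fun=> th); first exact: cst_continuous.
  by split=> // t; exists 1; rewrite ?mul1r.
have [a0|a0|a0] := ltgtP a 0.
- by apply: (H trigo.pi); rewrite cospi sinpi; lra.
- by apply: (H 0); rewrite cos0 sin0; lra.
have [b0|b0|b0] := ltgtP b 0.
- apply: (H (- (trigo.pi / 2))).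
  by rewrite cosN sinN cos_pihalf sin_pihalf; lra.
- by apply: (H (trigo.pi / 2)); rewrite cos_pihalf sin_pihalf; lra.
- by case: ab; rewrite a0 b0.
Qed.

Lemma derivable_continuous (R : realType) (f : R -> R) :
  (forall t, derivable f t 1) -> continuous f.
Proof.
by move=> df t; apply: differentiable_continuous; apply/derivable1_diffP.
Qed.

Lemma derive1_quasi_periodic (R : realType) (x : R -> R) (a : R) :
  (forall t, x (t + 1) = x t + a) ->
  forall t, derive1 x (t + 1) = derive1 x t.
Proof.
move=> px t; rewrite /derive1.
set u := (fun h : R => _); set v := (fun h : R => _).
suff -> : u = v by [].
by apply/funext => h; rewrite /u /v addrA !px opprD addrACA subrr addr0.
Qed.

Lemma sum_squares_gt0 (R : realType) (a b : R) :
  (a, b) <> (0, 0) -> 0 < a * a + b * b.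
Proof.
move=> ab; rewrite lt0r -!expr2 paddr_eq0 ?sqr_ge0 // !sqrf_eq0.
rewrite addr_ge0 ?sqr_ge0 // andbT.
by apply/negP => /andP[/eqP a0 /eqP b0]; apply: ab; rewrite a0 b0.
Qed.

(** The set of the [h > 0] for which the secant field has a periodic angle is
    open and closed, because nearby nonvanishing fields make acute angles, and
    it contains 1, where the field is constant. *)
Lemma secant_has_periodic_angle (R : realType) (x y : R -> R) (a b : R) :
  continuous x -> continuous y ->
  (forall t, x (t + 1) = x t + a) -> (forall t, y (t + 1) = y t + b) ->
  (a, b) <> (0, 0) ->
  (forall s t, x s = x t -> y s = y t -> s = t) ->
  forall h, 0 < h ->
  has_periodic_angle (fun t => x (t + h) - x t) (fun t => y (t + h) - y t).
Proof.
move=> cx cy px py ab inj.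
pose X h t := x (t + h) - x t; pose Y h t := y (t + h) - y t.
have secant2 (f : R -> R) : continuous f ->
    continuous (fun z : R * R => f (z.1 + z.2) - f z.1).
  move=> cf z; apply: cvgB.
    apply: (@continuous_comp _ _ _ (fun z : R * R => z.1 + z.2) f).
      by apply: cvgD; [exact: cvg_fst|exact: cvg_snd].
    exact: cf.
  by apply: (@continuous_comp _ _ _ fst f); [exact: cvg_fst|exact: cf].
have secant1 (f : R -> R) h : continuous f ->
    continuous (fun t : R => f (t + h) - f t).
  move=> cf t; apply: cvgB; last exact: cf.
  apply: (@continuous_comp _ _ _ (fun z : R => z + h) f); last exact: cf.
  by apply: cvgD; [exact: cvg_id|exact: cvg_cst].
have cX h : continuous (X h) by exact: secant1.
have cY h : continuous (Y h) by exact: secant1.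
have pX h t : X h (t + 1) = X h t by rewrite /X addrAC !px; lra.
have pY h t : Y h (t + 1) = Y h t by rewrite /Y addrAC !py; lra.
have loc (h0 : R) : 0 < h0 -> \forall h \near h0, forall t,
    0 < X h0 t * X h t + Y h0 t * Y h t.
  move=> h00.
  apply: (@near_uniformly_periodic _ _ (nbhs h0)
    (fun h t => 0 < X h0 t * X h t + Y h0 t * Y h t)) => [h t|t].
    by rewrite !pX !pY.
  have : 0 < X h0 t * X h0 t + Y h0 t * Y h0 t.
    apply: sum_squares_gt0 => -[Xe Ye].
    suff : t + h0 = t by lra.
    by apply: inj; apply/eqP; rewrite -subr_eq0; apply/eqP.
  pose f (z : R * R) := X h0 z.1 * X z.2 z.1 + Y h0 z.1 * Y z.2 z.1.
  have cf : continuous f.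
    move=> z; apply: cvgD; apply: cvgM.
    + by apply: continuous_comp; [exact: cvg_fst|exact: cX].
    + exact: (secant2 x cx).
    + by apply: continuous_comp; [exact: cvg_fst|exact: cY].
    + exact: (secant2 y cy).
  rewrite -/(f (t, h0)) => f0.
  by have := cvgr_gt _ (cf (t, h0)) _ f0; apply.
pose P := fun h => has_periodic_angle (X h) (Y h).
have Pstep h h0 :
    (forall t, 0 < X h0 t * X h t + Y h0 t * Y h t) -> P h0 -> P h.
  by move=> p /has_periodic_angle_step; apply.
have P1 : P 1.
  have -> : P 1 = has_periodic_angle (fun=> a) (fun=> b).
    congr has_periodic_angle; apply/funext => t.
      by rewrite /X px addrC addKr.
    by rewrite /Y py addrC addKr.
  exact: has_periodic_angle_cst.
move=> h; change (0 < h -> P h).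
pose S := [set h : R | 0 < h].
have cS : connected S.
  apply/connected_intervalP => u v /= u0 v0 z /andP[uz _].
  exact: lt_le_trans uz.
suff : S `&` P = S by move=> SP h0; have : S h by []; rewrite -SP => -[].
apply: cS; first by exists 1; split=> //; exact: ltr01.
  exists (S `&` P); last by rewrite setIA setIid.
  rewrite openE => h0 [h00 Ph0]; near=> k; split.
    by near: k; exact: lt_nbhsr.
  by apply: Pstep Ph0; near: k; exact: loc.
exists (~` (S `&` ~` P)); last by rewrite setCI setCK setIUr setICr set0U.
apply: open_closedC; rewrite openE => h0 [h00 Ph0]; near=> k; split.
  by near: k; exact: lt_nbhsr.
move=> Ph; apply: Ph0; apply: Pstep Ph => t; rewrite mulrC [X in _ + X]mulrC.
by move: t; near: k; exact: loc.
Unshelve. all: by end_near.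
Qed.

(** By the mean value theorem, the component of a secant along the velocity at
    its start is that of a velocity at a nearby time. *)
Lemma short_secant_acute (R : realType) (x y : R -> R) :
  (forall t, derivable x t 1) -> (forall t, derivable y t 1) ->
  continuous (derive1 x) -> continuous (derive1 y) ->
  (forall t, derive1 x (t + 1) = derive1 x t) ->
  (forall t, derive1 y (t + 1) = derive1 y t) ->
  (forall t, (derive1 x t, derive1 y t) <> (0, 0)) ->
  exists2 h, 0 < h & forall t,
    0 < (x (t + h) - x t) * derive1 x t + (y (t + h) - y t) * derive1 y t.
Proof.
move=> dx dy cx' cy' px' py' imm.
pose g s t := derive1 x s * derive1 x t + derive1 y s * derive1 y t.
have close : \forall h \near (0 : R)^'+, forall t s,
    t <= s <= t + h -> 0 < g s t.
  apply: (@near_uniformly_periodic _ _ ((0 : R)^'+)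
    (fun h t => forall s, t <= s <= t + h -> 0 < g s t)) => [h t|t].
    split=> H s /andP[s1 s2].
      have : 0 < g (s + 1) (t + 1) by apply: H; lra.
      by rewrite /g !px' !py'.
    by rewrite -[s](subrK 1) /g !px' !py'; apply: H; lra.
  have g0 : 0 < g t t by exact: sum_squares_gt0.
  have cg : continuous (fun z : R * R => g z.1 z.2).
    move=> z; apply: cvgD; apply: cvgM.
    + by apply: continuous_comp; [exact: cvg_fst|exact: cx'].
    + by apply: continuous_comp; [exact: cvg_snd|exact: cx'].
    + by apply: continuous_comp; [exact: cvg_fst|exact: cy'].
    + by apply: continuous_comp; [exact: cvg_snd|exact: cy'].
  have : nbhs ((t, t) : R * R) [set z | 0 < g z.1 z.2].
    by have := cvgr_gt _ (cg (t, t)) _ g0; apply.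
  move=> /nbhs_ballP[e /= e0 He].
  near=> t' h => s /= /andP[s1 s2].
  have t'e : `|t - t'| < e / 2.
    by near: t'; apply: nbhsx_ballx; rewrite divr_gt0.
  have he : h < e / 2 by near: h; apply: nbhs_right_lt; rewrite divr_gt0.
  apply: (He (s, t')); split=> /=; rewrite /ball /=;
    by move: t'e; rewrite !ltr_norml; lra.
near (0 : R)^'+ => h; exists h; first by near: h; exact: nbhs_right_gt.
have h0 : 0 < h by near: h; exact: nbhs_right_gt.
have Hh : forall t s, t <= s <= t + h -> 0 < g s t by near: h; exact: close.
move=> t; pose f s := x s * derive1 x t + y s * derive1 y t.
have df (s : R) : is_derive s 1 f (g s t).
  have -> : f = (fun s => derive1 x t *: x s + derive1 y t *: y s).
    by apply/funext => u; rewrite /f [x u * _]mulrC [y u * _]mulrC.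
  have dxs : is_derive s 1 x (derive1 x s).
    by rewrite derive1E; exact: derivableP.
  have dys : is_derive s 1 y (derive1 y s).
    by rewrite derive1E; exact: derivableP.
  have := is_deriveD (is_deriveZ (derive1 x t) dxs)
    (is_deriveZ (derive1 y t) dys).
  by rewrite /g ![_ *: derive1 _ s]mulrC.
have th : t < t + h by lra.
have [|s + fE] := MVT th (fun s _ => df s).
  by apply: derivable_within_continuous => s _; apply: ex_derive.
rewrite in_itv /= => /andP[s1 s2].
have := Hh t s; rewrite (ltW s1) (ltW s2) => /(_ isT) p.
have -> : (x (t + h) - x t) * derive1 x t + (y (t + h) - y t) * derive1 y t =
    f (t + h) - f t by rewrite /f; ring.
by rewrite fE mulr_gt0 //; lra.
Unshelve. all: by end_near.
Qed.

Lemma velocity_has_periodic_angle (R : realType) (x y : R -> R) (a b : R) :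
  (forall t, derivable x t 1) -> (forall t, derivable y t 1) ->
  continuous (derive1 x) -> continuous (derive1 y) ->
  (forall t, x (t + 1) = x t + a) -> (forall t, y (t + 1) = y t + b) ->
  (a, b) <> (0, 0) ->
  (forall s t, x s = x t -> y s = y t -> s = t) ->
  (forall t, (derive1 x t, derive1 y t) <> (0, 0)) ->
  has_periodic_angle (derive1 x) (derive1 y).
Proof.
move=> dx dy cx' cy' px py ab inj imm.
have cx := derivable_continuous dx; have cy := derivable_continuous dy.
have px' := derive1_quasi_periodic px.
have py' := derive1_quasi_periodic py.
have [h h0 acute] := short_secant_acute dx dy cx' cy' px' py' imm.
have secant := secant_has_periodic_angle cx cy px py ab inj h0.
exact: has_periodic_angle_step secant cx' cy' px' py' acute.
Qed.

(** * Simple closed curves in the torus *)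

Lemma open_nonint (R : realType) :
  open [set x : R | ~ exists n : int, x = n%:~R].
Proof.
rewrite openE => x /= xN.
have fx : (Num.floor x)%:~R < x.
  rewrite lt_neqAle floor_le_tmp andbT; apply/eqP => xE.
  by apply: xN; exists (Num.floor x); rewrite xE.
have xf := floorD1_gt x.
near=> z => -[n zE].
have /andP[] : (Num.floor x < n < Num.floor x + 1)%R.
  rewrite -!(ltr_int R) -zE; apply/andP; split; near: z.
    exact: lt_nbhsr.
  exact: lt_nbhsl.
lia.
Unshelve. all: by end_near.
Qed.

Section Torus.
Context (R : realType) (T : topologicalType) (pr : R * R -> T).
Hypothesis hpr : torus_covering pr.

(** Two points of the plane have different images when a coordinate of their
    difference is not an integer, and this is an open condition; the covering
    map is open. *)
Lemma torus_hausdorff : hausdorff_space T.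
Proof.
rewrite open_hausdorff => p q /eqP pq.
have [z zp] := torus_surj hpr p; have [w wq] := torus_surj hpr q.
pose N := [set x : R | ~ exists n : int, x = n%:~R].
have coord (f : R * R -> R) : continuous f ->
    (forall z' w', pr z' = pr w' -> exists n : int, f w' - f z' = n%:~R) ->
    N (f w - f z) -> \forall u \near (z, w), pr u.1 <> pr u.2.
  move=> cf Hf Nf.
  have cd : continuous (fun u : (R * R) * (R * R) => f u.2 - f u.1).
    move=> u; apply: cvgB.
      by apply: (@continuous_comp _ _ _ snd f); [exact: cvg_snd|exact: cf].
    by apply: (@continuous_comp _ _ _ fst f); [exact: cvg_fst|exact: cf].
  have : nbhs (f (z, w).2 - f (z, w).1) N.
    by apply: open_nbhs_nbhs; split; [exact: open_nonint|].
  move=> /(cd (z, w)) H; have : \forall u \near (z, w), N (f u.2 - f u.1) by [].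
  by apply: filterS => u /= Nu /Hf.
have key : \forall u \near (z, w), pr u.1 <> pr u.2.
  have [[m mE]|] := pselect (exists n : int, w.1 - z.1 = n%:~R); last first.
    apply: coord => [u|z' w' /(torus_fibre hpr)[a [b ->]]].
      exact: cvg_fst.
    by exists a => /=; rewrite addrC addKr.
  have [[n nE]|] := pselect (exists n : int, w.2 - z.2 = n%:~R); last first.
    apply: coord => [u|z' w' /(torus_fibre hpr)[a [b ->]]].
      exact: cvg_snd.
    by exists b => /=; rewrite addrC addKr.
  case: pq; rewrite -zp -wq; apply/(torus_fibre hpr); exists m, n.
  by rewrite -mE -nE ![_ + (_ - _)]addrC !subrK; case: (w).
move: key => [[U W] /= [Uz Ww] UW].
move: Uz Ww; rewrite !nbhsE => -[U' [oU U'z] U'U] [W' [oW W'w] W'W].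
exists (pr @` U', pr @` W') => /=.
  by split; rewrite inE; [exists z|exists w].
split; [exact: torus_open|exact: torus_open|].
apply/eqP/seteqP; split=> // r [[u U'u ur] [v W'v vr]].
by apply: (UW (u, v)); [split; [exact: U'U|exact: W'W]|rewrite /= ur vr].
Qed.

End Torus.

Section SimpleLoop.
Context (R : realType) (T : topologicalType) (c : R -> T) (C : set T).
Hypothesis hT : hausdorff_space T.
Hypothesis cc : continuous c.
Hypothesis c1 : forall t, c (t + 1) = c t.
Hypothesis cinj : forall s t, c s = c t -> same_time s t.

Lemma loop_int (n : int) t : c (t + n%:~R) = c t.
Proof.
have := @periodic_int R (fun u => c u = c t) _ n t; move=> [| _ ->] //.
by move=> u; rewrite c1.
Qed.

Lemma loop_inj s t : `|s - t| < 1 -> c s = c t -> s = t.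
Proof.
move=> st /cinj[n tE]; move: st; rewrite tE opprD addrA subrr sub0r normrN.
by move=> /eq0_of_norm_lt1 ->; rewrite addr0.
Qed.

Lemma loop_shift s t : exists2 v, s <= v < s + 1 & c v = c t.
Proof.
exists (t + (- Num.floor (t - s))%:~R); last exact: loop_int.
have := floor_le_tmp (t - s); have := floorD1_gt (t - s).
rewrite intrD mulrNz; lra.
Qed.

Lemma loop_image_closed s t : closed (c @` `[s, t]).
Proof.
apply: compact_closed => //; apply: continuous_compact.
  exact: continuous_subspaceT.
exact: segment_compact.
Qed.

(** The arc is connected, and it is relatively open and closed in the curve
    minus [C]: closed because it is cut out by the compact arc over [[s, t]],
    open because it is the complement of the compact arc over [[t, s + 1]]. *)
Lemma arc_component s t u :
  s < t -> t <= s + 1 -> C (c s) -> C (c t) ->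
  (forall v, s < v < t -> ~ C (c v)) -> s < u < t ->
  connected_component (range c `\` C) (c u) = c @` `]s, t[.
Proof.
move=> st t1 Cs Ct Cst ust.
have Uu : (c @` `]s, t[) (c u) by exists u; rewrite //= in_itv.
have UA : c @` `]s, t[ `<=` range c `\` C.
  by move=> _ [v + <-]; rewrite /= in_itv /= => /Cst nC; split=> //; exists v.
have conU : connected (c @` `]s, t[).
  apply: connected_continuous_connected; last exact: continuous_subspaceT.
  exact/connected_intervalP/interval_is_interval.
set A := range c `\` C in UA *.
have UW : c @` `]s, t[ `<=` connected_component A (c u).
  by have := connected_component_max Uu UA conU.
apply/seteqP; split=> //; set W := connected_component A (c u) in UW *.
have WA : W `<=` A by exact: connected_component_sub.
suff <- : W `&` c @` `]s, t[ = W by move=> ? [].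
apply: component_connected.
- by exists (c u); split=> //; exact: UW.
- exists (~` (c @` `[t, s + 1])); first exact/closed_openC/loop_image_closed.
  apply/seteqP; split=> p [Wp].
    move=> [v]; rewrite /= in_itv /= => /andP[sv vt] vp; split=> //.
    move=> -[w]; rewrite /= in_itv /= -vp => /andP[tw w1] cwv.
    have : w = v by apply: loop_inj; rewrite ?ltr_norml //; lra.
    by lra.
  move=> nW; split=> //; have [[v0 _ v0p] nC] := WA _ Wp.
  have [v /andP[sv v1] vp] := loop_shift s v0.
  exists v; last by rewrite vp.
  rewrite /= in_itv /= !lt_neqAle sv andbT; apply/and3P; split.
  + by apply/eqP => sE; apply: nC; rewrite -v0p -vp -sE.
  + by apply/eqP => tE; apply: nC; rewrite -v0p -vp tE.
  + rewrite leNgt; apply/negP => tv; apply: nW; exists v; last by rewrite vp.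
    by rewrite /= in_itv /=; lra.
- exists (c @` `[s, t]); first exact: loop_image_closed.
  apply/seteqP; split=> p [Wp] [v]; rewrite /= in_itv /= => /andP[sv vt] vp.
    by split=> //; exists v => //; rewrite /= in_itv /= !ltW.
  split=> //; have [_ nC] := WA _ Wp; exists v => //.
  rewrite /= in_itv /= !lt_neqAle sv vt !andbT; apply/andP; split.
  + by apply/eqP => sE; apply: nC; rewrite -vp -sE.
  + by apply/eqP => tE; apply: nC; rewrite -vp tE.
Qed.

Lemma circle_component u : (forall t, ~ C (c t)) ->
  connected_component (range c `\` C) (c u) = range c.
Proof.
move=> nC; have -> : range c `\` C = range c.
  by apply/seteqP; split=> p; [case|move=> [v _ <-]; split=> //; exists v].
apply: connected_component_id; first by exists u.
apply: connected_continuous_connected; last exact: continuous_subspaceT.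
by apply/connected_intervalP => ? ? ? ? ? ?.
Qed.

(** Isolation of points of the torus passes to times, since distinct close
    times have distinct images. *)
Lemma critical_times_isolated : (forall p, \forall q \near p^', ~ C q) ->
  forall t, exists2 e, 0 < e & forall u, `|u - t| < e -> u <> t -> ~ C (c u).
Proof.
move=> iso t.
have : \forall u \near t, u <> t -> ~ C (c u).
  have := iso (c t); rewrite near_withinE => /(cc (x := t)) H.
  near=> u => ut; have : c u != c t -> ~ C (c u) by near: u; exact: H.
  apply; apply/eqP => /loop_inj ut'; apply: ut; apply: ut'.
  by rewrite distrC; near: u; exact: nbhsx_ballx.
move=> /nbhs_ballP[e /= e0 He]; exists e => // u ue.
by apply: He; rewrite /ball /= distrC.
Unshelve. all: by end_near.
Qed.

End SimpleLoop.

(** * Enumeration of a discrete periodic set of times *)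

(** A closed discrete set that is unbounded above contains a first element after
    each time; iterating this successor from [t0] reaches [t0 + 1], since otherwise
    the supremum of the iterates would be an accumulation point.  The half-open
    intervals between successive elements then cover one period exactly. *)
Lemma periodic_discrete_enumeration (R : realType) (C : set R) (t0 : R) :
  C t0 -> (forall t, C (t + 1) <-> C t) ->
  (forall t, exists2 e, 0 < e & forall u, `|u - t| < e -> u <> t -> ~ C u) ->
  exists (N : nat) (tt : nat -> R),
  [/\ [/\ (0 < N)%N, forall j, C (tt j) & forall j, tt j < tt j.+1],
      forall j u, tt j < u < tt j.+1 -> ~ C u,
      forall j, tt (j + N)%N = tt j + 1 &
      forall u, exists2 j, (j < N)%N &
        exists n : int, tt j < u + n%:~R <= tt j.+1].
Proof.
move=> Ct0 C1 iso.
pose next t u := [/\ t < u, C u & forall v, t < v < u -> ~ C v].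
have next_uniq t u u' : next t u -> next t u' -> u = u'.
  move=> [tu Cu Hu] [tu' Cu' Hu']; have [uu'|uu'|//] := ltgtP u u'.
    by case: (Hu' u); rewrite ?tu.
  by case: (Hu u'); rewrite ?tu'.
have Cint (n : int) : C (t0 + n%:~R) by apply/periodic_int.
have next_ex t : exists u, next t u.
  pose S := [set u | t < u /\ C u].
  have S0 : S !=set0.
    (* The first translate of [t0] beyond [t]. *)
    exists (t0 + (Num.floor (t - t0) + 1)%:~R); split=> //.
    by have := floorD1_gt (t - t0); lra.
  have infS : has_inf S by split=> //; exists t => u [/ltW].
  have [e e0 He] := iso t; have [d d0 Hd] := iso (inf S).
  have tS u : S u -> t + e <= u.
    move=> [tu Cu]; rewrite leNgt; apply/negP => ue.
    by apply: (He u) => //; [rewrite ltr_norml|]; lra.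
  have tinf : t + e <= inf S by apply: lb_le_inf.
  have [u Su ud] := inf_adherent d0 infS.
  have iu : inf S <= u by apply: ge_inf => //; exists t => v [/ltW].
  have uE : u = inf S.
    apply: contrapT => uN; apply: (Hd u _ uN Su.2); rewrite ltr_norml; lra.
  exists u; split; [exact: Su.1|exact: Su.2|move=> v /andP[tv vu] Cv].
  have : inf S <= v by apply: ge_inf; [exists t => w [/ltW]|].
  by rewrite -uE leNgt vu.
have [f Hf] := choice next_ex.
pose tt j := iter j f t0.
have ttS j : next (tt j) (tt j.+1) by exact: Hf.
have Ctt j : C (tt j) by case: j => [|j] //; have [] := ttS j.
have ltt j : tt j < tt j.+1 by have [] := ttS j.
have ltn_tt : {homo tt : i j / (i < j)%N >-> i < j}.
  by apply: homo_ltn => //; exact: lt_trans.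
have ex : exists j, t0 + 1 <= tt j.
  apply: contrapT => /forallNP H.
  have {}H j : tt j < t0 + 1 by rewrite ltNge; apply/negP/H.
  have supS : has_sup (range tt).
    by split; [exists t0, 0%N|exists (t0 + 1) => _ [j _ <-]; exact: ltW].
  have [e e0 He] := iso (sup (range tt)).
  have [_ [j _ <-] je] := sup_adherent e0 supS.
  have up i : tt i <= sup (range tt) by apply: (ub_le_sup supS.2); exists i.
  by apply: (He (tt j)) => //; [rewrite ltr_norml|];
    have := up j; have := up j.+1; have := ltt j; lra.
case: (ex_minnP ex) => N HN Nmin.
have N0 : (0 < N)%N by case: N HN {Nmin} => //= ; lra.
have ttN : tt N = t0 + 1.
  apply/eqP; rewrite eq_le HN andbT leNgt; apply/negP => lt.
  case: N N0 HN Nmin lt => // N _ HN Nmin lt.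
  have [_ _ /(_ (t0 + 1))] := ttS N; apply; last by rewrite C1.
  rewrite lt andbT ltNge; apply/negP => /Nmin; lia.
have ttD j : tt (j + N)%N = tt j + 1.
  elim: j => [|j IH]; first by rewrite add0n ttN.
  apply: (@next_uniq (tt (j + N)%N)); first by rewrite addSn; exact: ttS.
  have [a b h] := ttS j; rewrite IH; split; first by lra.
    by rewrite C1.
  move=> v Hv; rewrite -[v](subrK 1) C1; apply: h; lra.
exists N, tt; split=> //; first by move=> j u; have [_ _] := ttS j; apply.
move=> u; pose m := Num.floor (t0 - u) + 1; pose v := u + m%:~R.
have v01 : tt 0%N < v <= tt N.
  rewrite ttN /v /m intrD mulr1z /=.
  have := floor_le_tmp (t0 - u); have := floorD1_gt (t0 - u).
  by rewrite intrD mulr1z; lra.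
have find k : tt 0%N < v <= tt k -> exists2 j, (j < k)%N & tt j < v <= tt j.+1.
  elim: k => [|k IH]; first by lra.
  case: (leP v (tt k)) => vk /andP[v0 vk1].
    by have [|j jk Hj] := IH; [rewrite v0|exists j => //; exact: ltnW].
  by exists k => //; rewrite vk.
by have [j jN jv] := find _ v01; exists j => //; exists m.
Qed.

(** * The angle between and at the extrema of the height *)

Section AngleStrips.
Context (R : realType).
Implicit Types (th y : R -> R) (s t c : R) (e : int).
Local Notation PI := (@trigo.pi R).

Lemma sin_int (a : R) (n : int) : sin (a - 2 * PI * n%:~R) = sin a.
Proof.
have := @periodic_int R (fun u => sin (a - 2 * PI * u) = sin a) _ n 0.
rewrite mulr0 subr0 add0r => -[|_ ->] // t.
have -> : a - 2 * PI * t = (a - 2 * PI * (t + 1)) + PI *+ 2.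
  by rewrite mulr2n; ring.
by rewrite sinD2pi.
Qed.

Lemma cos_int (a : R) (n : int) : cos (a - 2 * PI * n%:~R) = cos a.
Proof.
have := @periodic_int R (fun u => cos (a - 2 * PI * u) = cos a) _ n 0.
rewrite mulr0 subr0 add0r => -[|_ ->] // t.
have -> : a - 2 * PI * t = (a - 2 * PI * (t + 1)) + PI *+ 2.
  by rewrite mulr2n; ring.
by rewrite cosD2pi.
Qed.

Lemma sin_lt0 (a : R) : - PI < a < 0 -> sin a < 0.
Proof.
by move=> ha; rewrite -oppr_gt0 -sinN; apply: sin_gt0_pi; lra.
Qed.

(** The angle starts in a strip where the sine is nonnegative; to leave it, it
    would take a value just outside, where the sine is negative. *)
Lemma upper_strip th s t : s <= t -> continuous th ->
  (forall u, s <= u <= t -> 0 <= sin (th u)) ->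
  exists e, forall u, s <= u <= t -> 0 <= th u - 2 * PI * e%:~R <= PI.
Proof.
move=> st cth sth; have p0 := pi_gt0 R.
pose e := Num.floor (th s / (2 * PI)); exists e.
pose w u := th u - 2 * PI * e%:~R.
have cw : continuous w by move=> u; apply: cvgB; [exact: cth|exact: cvg_cst].
have sw u : s <= u <= t -> 0 <= sin (w u) by rewrite /w sin_int; exact: sth.
have ws : 0 <= w s <= PI.
  have := floor_le_tmp (th s / (2 * PI)); rewrite ler_pdivlMr; last by lra.
  have := floorD1_gt (th s / (2 * PI)); rewrite ltr_pdivrMr; last by lra.
  rewrite -/e intrD mulr1z => h1 h2.
  have w0 : 0 <= w s by rewrite /w; lra.
  rewrite w0 /= leNgt; apply/negP => wp.
  have : sin (w s - 2 * PI * 1%:~R) < 0.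
    by apply: sin_lt0; move: wp; rewrite /w mulr1z; lra.
  by rewrite sin_int ltNge sw // lexx.
have ivt u v : s <= u <= t -> Num.min (w s) (w u) <= v <= Num.max (w s) (w u) ->
    0 <= sin v.
  move=> /andP[su ut] Hv.
  have [|z + <-] := IVT su _ Hv; first exact: continuous_subspaceT.
  by rewrite in_itv /= => /andP[sz zu]; apply: sw; rewrite sz (le_trans zu).
(* The values [max (w u) (- pi / 2)] and [min (w u) (3 pi / 2)] lie between
   [w s] and [w u], in the ranges just below 0 and just above [pi]. *)
move=> u ut; rewrite -/(w u).
apply/andP; split; rewrite leNgt; apply/negP => wu.
  have /(ivt u _ ut) : Num.min (w s) (w u) <= Num.max (w u) (- PI / 2)
      <= Num.max (w s) (w u).
    apply/andP; split; first by rewrite ge_min !le_max lexx orbT.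
    by rewrite ge_max !le_max lexx orbT /=; apply/orP; left; lra.
  rewrite leNgt sin_lt0 // lt_max gt_max; apply/andP; split; last by lra.
  by apply/orP; right; lra.
have /(ivt u _ ut) : Num.min (w s) (w u) <= Num.min (w u) (3 / 2 * PI)
    <= Num.max (w s) (w u).
  apply/andP; split; last by rewrite ge_min !le_max lexx !orbT.
  by rewrite le_min !ge_min lexx orbT /=; apply/orP; left; lra.
rewrite -(sin_int _ 1) leNgt sin_lt0 // mulr1z.
have : PI < Num.min (w u) (3 / 2 * PI) by rewrite lt_min wu; lra.
have : Num.min (w u) (3 / 2 * PI) <= 3 / 2 * PI by rewrite ge_min lexx orbT.
by move: (Num.min _ _) => z; lra.
Qed.

Definition strict_incr y s t :=
  forall u v, s <= u -> u < v -> v <= t -> y u < y v.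

Definition strict_decr y s t :=
  forall u v, s <= u -> u < v -> v <= t -> y v < y u.

(** A continuous function taking a value twice has an extremum in between, so
    without interior extremum it is injective. *)
Lemma strict_monotone_between y s t : continuous y ->
  (forall u, s < u < t -> ~ (\forall v \near u, y v <= y u) /\
                          ~ (\forall v \near u, y u <= y v)) ->
  strict_incr y s t \/ strict_decr y s t.
Proof.
move=> cy ext.
have near_max u v z : s <= u -> v <= t -> u < z < v ->
    ~ (forall w, w \in `[u, v] -> y w <= y z).
  move=> su vt /andP[uz zv] H; have [|+ _] := ext z; first by lra.
  apply; near=> w; apply: H; rewrite in_itv /=.
  apply/andP; split; apply: ltW; near: w.
    exact: lt_nbhsr.
  exact: lt_nbhsl.
have near_min u v z : s <= u -> v <= t -> u < z < v ->
    ~ (forall w, w \in `[u, v] -> y z <= y w).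
  move=> su vt /andP[uz zv] H; have [|_ +] := ext z; first by lra.
  apply; near=> w; apply: H; rewrite in_itv /=.
  apply/andP; split; apply: ltW; near: w.
    exact: lt_nbhsr.
  exact: lt_nbhsl.
have inj' u v : s <= u -> u < v -> v <= t -> y u <> y v.
  move=> su uv vt uvE.
  have cw : {within `[u, v], continuous y} by exact: continuous_subspaceT.
  have [a ai amax] := EVT_max (ltW uv) cw.
  have [b bi bmin] := EVT_min (ltW uv) cw.
  have endp z : z \in `[u, v] -> ~ u < z < v -> y z = y u.
    rewrite in_itv /= => /andP[uz zv] nz.
    have [->//|zu] := eqVneq z u; have [->//|zv'] := eqVneq z v.
    by case: nz; rewrite !lt_neqAle uz zv zv' eq_sym zu.
  have [/near_max|/(endp _ ai) ya] := pselect (u < a < v); first exact.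
  have [/near_min|/(endp _ bi) yb] := pselect (u < b < v); first exact.
  have := @near_max u v ((u + v) / 2) su vt; apply; first by lra.
  move=> w /amax; rewrite ya => /le_trans; apply; rewrite -yb; apply: bmin.
  by rewrite in_itv /=; lra.
have inj : {in `[s, t] &, injective y}.
  move=> u v; rewrite !in_itv /= => /andP[su ut] /andP[sv vt] uvE.
  by have [uv|uv|//] := ltgtP u v; [case: (inj' u v)|case: (inj' v u)].
have := itv_continuous_inj_mono (continuous_subspaceT cy) inj.
case=> H; [left|right] => u v su uv vt.
  by apply: H => //; rewrite in_itv /=; lra.
by apply: H => //; rewrite in_itv /=; lra.
Unshelve. all: by end_near.
Qed.

(** The integer [e] counts the passages of the direction through the horizontal
    direction to the left.  It numbers the closed intervals of length [2 pi]
    between two such passages, and not those of length [pi] between horizontal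
    directions, so that it is unchanged at extrema oriented to the right. *)
Definition arc_index th y s t e :=
  (strict_incr y s t /\
    forall u, s <= u <= t -> 0 <= th u - 2 * PI * e%:~R <= PI) \/
  (strict_decr y s t /\
    forall u, s <= u <= t -> - PI <= th u - 2 * PI * e%:~R <= 0).

Lemma ge0_closed_itv (f : R -> R) s t : continuous f -> s < t ->
  (forall u, s < u < t -> 0 <= f u) -> forall u, s <= u <= t -> 0 <= f u.
Proof.
move=> cf st H u /andP[su ut]; rewrite leNgt; apply/negP => fu.
have fu' : \forall v \near u, f v < 0 by exact: (cvgr_lt _ (cf u)).
have [fl fr] := near_one_sided fu'.
have [us|us] := ltP u t.
  near u^'+ => v; have : f v < 0 by near: v; exact: fr.
  rewrite ltNge H //; apply/andP; split; last by near: v; exact: nbhs_right_lt.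
  by apply: le_lt_trans su _; near: v; exact: nbhs_right_gt.
have us' : s < u by exact: lt_le_trans us.
near u^'- => v; have : f v < 0 by near: v; exact: fl.
rewrite ltNge H //; apply/andP; split; first by near: v; exact: nbhs_left_gt.
by apply: lt_le_trans ut; near: v; exact: nbhs_left_lt.
Unshelve. all: by end_near.
Qed.

Lemma arc_index_exists th y s t : s < t -> continuous th ->
  (forall u, derivable y u 1) ->
  (forall u, exists2 r, 0 < r & derive1 y u = r * sin (th u)) ->
  (forall u, s < u < t -> ~ (\forall v \near u, y v <= y u) /\
                          ~ (\forall v \near u, y u <= y v)) ->
  exists e, arc_index th y s t e.
Proof.
move=> st cth dy yth ext.
have cy := derivable_continuous dy.
have [inc|dec] := strict_monotone_between cy ext.
  have [|e He] := @upper_strip th s t (ltW st) cth; last by exists e; left.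
  apply: ge0_closed_itv => // [u|u ust].
    by apply: continuous_comp; [exact: cth|exact: continuous_sin].
  have [r r0] := yth u; rewrite -(pmulr_rge0 _ r0) => <-.
  apply: (@incr_derive1_ge0_itv _ y true false s t) => // v w.
  by rewrite !in_itv /= => /andP[sv _] /andP[_ wt] vw; apply: inc.
have cth' : continuous (fun u => - th u) by move=> u; apply: cvgN; exact: cth.
have [|e He] := @upper_strip (fun u => - th u) s t (ltW st) cth'.
  apply: ge0_closed_itv => // [u|u ust].
    by apply: (@continuous_comp _ _ _ (fun u => - th u) sin);
      [exact: cth'|exact: continuous_sin].
  have [r r0 yE] := yth u; rewrite sinN oppr_ge0 -(pmulr_rle0 _ r0) -yE.
  apply: (@decr_derive1_le0_itv _ y true false s t) => // v w.
  by rewrite !in_itv /= => /andP[_ vt] /andP[sw _] wv; apply: dec.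
exists (- e); right; split=> // u /He; rewrite mulrNz; lra.
Unshelve. all: by end_near.
Qed.

Lemma arc_index_uniq th y s t e e' : s < t ->
  arc_index th y s t e -> arc_index th y s t e' -> e = e'.
Proof.
move=> st.
have p0 := pi_gt0 R.
have key (a b : R) : `|a - b| <= PI -> a - b = 2 * PI * (e' - e)%:~R -> e = e'.
  move=> ab abE; apply/esym/eqP; rewrite -subr_eq0.
  apply/eqP/(@eq0_of_norm_lt1 R).
  move: ab; rewrite abE normrM (gtr0_norm (_ : 0 < 2 * PI)); last by lra.
  move: `|_| => z; nra.
have inc_dec : strict_incr y s t -> strict_decr y s t -> False.
  by move=> /(_ s t (lexx _) st (lexx _)) + /(_ s t (lexx _) st (lexx _)); lra.
have ss : s <= s <= t by rewrite lexx ltW.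
move=> [[i He]|[i He]] [[i' He']|[i' He']]; try by case: (inc_dec).
all: apply: (key (th s - 2 * PI * e%:~R) (th s - 2 * PI * e'%:~R));
  last by rewrite intrB; ring.
all: by have := He _ ss; have := He' _ ss; rewrite ler_norml; lra.
Qed.

(** At a maximum the angle lies both in the strip [[0, pi]] above [2 pi e] and
    in the strip [[- pi, 0]] below [2 pi e'].  If the curve points to the right
    there, the angle is the common value [2 pi e = 2 pi e']; if it points to the
    left, it is [2 pi e + pi = 2 pi e' - pi]. *)
Lemma turn_at_max th y s c t e e' : s < c -> c < t ->
  arc_index th y s c e -> arc_index th y c t e' ->
  (\forall u \near c, y u <= y c) ->
  sin (th c) = 0 /\ (0 < cos (th c) -> e' = e) /\ (cos (th c) < 0 -> e' = e + 1).
Proof.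
move=> sc ct ie ie' cmax.
have [cl cr] := near_one_sided cmax; have p0 := pi_gt0 R.
have nd : ~ strict_decr y s c.
  move=> d; near c^'- => u.
  have uc : u < c by near: u; exact: nbhs_left_lt.
  have su : s < u by near: u; exact: nbhs_left_gt.
  have := d u c (ltW su) uc (lexx _); rewrite ltNge => /negP; apply.
  by near: u; exact: cl.
have ni : ~ strict_incr y c t.
  move=> d; near c^'+ => u.
  have uc : c < u by near: u; exact: nbhs_right_gt.
  have su : u < t by near: u; exact: nbhs_right_lt.
  have := d c u (lexx _) uc (ltW su); rewrite ltNge => /negP; apply.
  by near: u; exact: cr.
case: ie => -[] // _ /(_ c); rewrite lexx (ltW sc) => /(_ isT) a0.
case: ie' => -[] // _ /(_ c); rewrite lexx (ltW ct) => /(_ isT) a1.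
set a := th c - 2 * PI * e%:~R in a0.
have aE : th c - 2 * PI * e'%:~R = a - 2 * PI * (e' - e)%:~R.
  by rewrite intrB /a; ring.
have s0 : sin a = 0.
  apply/eqP; rewrite eq_le sin_ge0_pi // andbT sin_int -(sin_int _ e').
  by rewrite -oppr_ge0 -sinN; apply: sin_ge0_pi; lra.
split; first by rewrite -(sin_int _ e).
rewrite -(cos_int _ e) -/a; rewrite aE in a1.
have [a00|an0] := eqVneq a 0.
  rewrite a00 cos0; split; last by rewrite ltr10.
  move=> _; apply/eqP; rewrite -subr_eq0; apply/eqP/(@eq0_of_norm_lt1 R).
  move: a1; rewrite a00 ltr_norml; move: (e' - e)%:~R => z /andP[z1 z2].
  have : PI * z <= PI * (1 / 2) by lra.
  have : PI * 0 <= PI * z by lra.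
  by rewrite !ler_pM2l //; lra.
have aPI : a = PI.
  apply/eqP; rewrite eq_le (andP a0).2 leNgt /=; apply/negP => ap.
  have := @sin_gt0_pi R a.
  by rewrite s0 ltxx ap andbT lt0r an0 (andP a0).1 => /(_ isT).
rewrite aPI cospi; split; first by rewrite oppr_gt0 ltr10.
move=> _; apply/eqP; rewrite -subr_eq0 opprD addrA.
apply/eqP/(@eq0_of_norm_lt1 R).
move: a1; rewrite aPI [X in `|X|]intrB mulr1z ltr_norml.
move: (e' - e)%:~R => z /andP[z1 z2].
have : PI * z <= PI * 1 by lra.
have : PI * (1 / 2) <= PI * z by lra.
by rewrite !ler_pM2l //; lra.
Unshelve. all: by end_near.
Qed.

(** This is the case of a maximum reflected in the horizontal axis. *)
Lemma turn_at_min th y s c t e e' : s < c -> c < t ->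
  arc_index th y s c e -> arc_index th y c t e' ->
  (\forall u \near c, y c <= y u) ->
  sin (th c) = 0 /\ (0 < cos (th c) -> e' = e) /\ (cos (th c) < 0 -> e' = e - 1).
Proof.
move=> sc ct ie ie' cmin.
have opp u v k : arc_index th y u v k ->
    arc_index (fun z => - th z) (fun z => - y z) u v (- k).
  case=> -[m H]; [right|left];
    (split=> [z w uz zw wv|z /H]; last by rewrite mulrNz; lra);
    by rewrite ltrN2; apply: m.
have [|s0 [H1 H2]] := turn_at_max sc ct (opp _ _ _ ie) (opp _ _ _ ie').
  by apply: filterS cmin => u; rewrite lerN2.
move: s0 H1 H2; rewrite sinN cosN => /eqP; rewrite oppr_eq0 => /eqP s0 H1 H2.
split=> //; split=> [/H1|/H2]; lia.
Qed.

End AngleStrips.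

(** * Matrices of the local operators *)

Section LocalOperators.
Context (C : fieldType) (A : algType C) (H : quasitriangular_hopf A).
Context (V : based_module A) (hV : is_module V).
Local Notation n := (msize V).
Local Notation bas V := (tnth (mbasis V)).
Local Notation dbas V :=
  (fun k => tnth (mbasis (dual_module H V)) k : 'Hom(mcarrier V, C^o)).

Definition action_matrix (a : A) : 'M[C]_n :=
  \matrix_(k, l) coord (mbasis V) k (mact V a (bas V l)).

Lemma dbasE k x : dbas V k x = coord (mbasis V) k x.
Proof.
rewrite /dual_module /= tnth_mktuple.
exact: (lfunE (coord (mbasis V) k : {linear _ -> C^o})).
Qed.

Lemma basis_free : free (mbasis V).
Proof. exact: basis_free (mbasisP hV). Qed.

Lemma coord_bas k l : coord (mbasis V) k (bas V l) = (k == l)%:R.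
Proof. by rewrite (tnth_nth 0) coord_free ?basis_free // eq_sym. Qed.

Lemma dbas_nth (j : 'I_n) : (mbasis (dual_module H V))`_j = dbas V j.
Proof. by cbv beta; rewrite (tnth_nth 0). Qed.

Lemma dual_basis_free : free (mbasis (dual_module H V)).
Proof.
apply/freeP => k k0 i.
have := congr1 (fun f : 'Hom(mcarrier V, C^o) => f (bas V i)) k0.
rewrite /= zero_lfunE sum_lfunE => <-; rewrite (bigD1 i) //= big1 => [|j ji].
  rewrite addr0 scale_lfunE dbas_nth (dbasE i) coord_bas eqxx; exact/esym/mulr1.
rewrite scale_lfunE dbas_nth (dbasE j) coord_bas (negPf ji); exact: mulr0.
Qed.

Lemma coord_dbas k l :
  coord (mbasis (dual_module H V)) k (dbas V l) = (k == l)%:R.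
Proof. by cbv beta; rewrite -dbas_nth coord_free ?dual_basis_free // eq_sym. Qed.

Lemma action_matrix1 : action_matrix 1 = 1%:M.
Proof. by apply/matrixP => k l; rewrite !mxE (mact1 hV) coord_bas. Qed.

Lemma action_matrixM a b :
  action_matrix (a * b) = action_matrix a *m action_matrix b.
Proof.
apply/matrixP => k l; rewrite !mxE (mactM hV).
rewrite [X in mact V a X](coord_basis (mbasisP hV) (memvf _)) !linear_sum /=.
apply: eq_bigr => j _; rewrite !linearZ /= !mxE mulrC -tnth_nth.
by [].
Qed.

Lemma cap_lrE (k l : 'I_n) : dbas V k (bas V l) = action_matrix 1 k l.
Proof. by rewrite dbasE mxE (mact1 hV). Qed.

Lemma cap_rlE mu (k l : 'I_n) :
  dbas V k (mact V mu (bas V l)) = action_matrix mu k l.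
Proof. by rewrite dbasE mxE. Qed.

Lemma cup_lrE (k l : 'I_n) :
  (\sum_e @tens C A V (dual_module H V) (bas V e) (dbas V e)) k l =
  action_matrix 1 k l.
Proof.
rewrite summxE action_matrix1 mxE (bigD1 k) //= big1 => [|e ek]; rewrite mxE.
  by rewrite addr0 coord_bas coord_dbas eqxx mul1r eq_sym.
by rewrite coord_bas eq_sym (negPf ek) mul0r.
Qed.

Lemma cup_rlE muV (k l : 'I_n) :
  (\sum_e @tens C A (dual_module H V) V (dbas V e) (mact V muV (bas V e))) l k =
  action_matrix muV k l.
Proof.
rewrite summxE mxE (bigD1 l) //= big1 => [|e el]; rewrite mxE.
  by rewrite addr0 coord_dbas eqxx mul1r.
by rewrite coord_dbas eq_sym (negPf el) mul0r.
Qed.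

End LocalOperators.

(** * Traces of telescoping cyclic products *)

Section Telescope.
Context (C : fieldType) (n : nat) (M M' : 'M[C]_n).
Hypothesis MM' : M *m M' = 1%:M.

(** The integer powers of [M], with its inverse [M'] as explicit data so that
    matrices of size zero are covered. *)
Definition mxpow (e : int) : 'M[C]_n :=
  match e with
  | Posz k => iter k (mulmx^~ M) 1%:M
  | Negz k => iter k.+1 (mulmx^~ M') 1%:M
  end.

Let M'M : M' *m M = 1%:M. Proof. exact: mulmx1C. Qed.

Lemma mxpowS e : mxpow (e + 1) = mxpow e *m M.
Proof.
case: e => k; first by rewrite -PoszD addn1.
rewrite NegzE /=; case: k => [|k].
  by rewrite addNr /= mul1mx M'M.
have -> : - k.+2%:Z + 1 = - k.+1%:Z by lia.
by rewrite -!NegzE /= -mulmxA M'M mulmx1.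
Qed.

Lemma mxpowB e : mxpow (e - 1) = mxpow e *m M'.
Proof. by rewrite -[X in mxpow X *m _](subrK 1) mxpowS -mulmxA MM' mulmx1. Qed.

Lemma mxpow_unit e : mxpow e \in unitmx.
Proof.
have uM : M \in unitmx by case/mulmx1_unit: MM'.
have uM' : M' \in unitmx by case/mulmx1_unit: MM'.
case: e => k /=; last rewrite unitmx_mul uM' andbT;
  by elim: k => [|k IH] /=; rewrite ?unitmx1 // unitmx_mul IH.
Qed.

End Telescope.

Section Trace.
Context (C : fieldType) (n : nat).
Implicit Types (W Q : nat -> 'M[C]_n).

Definition mxprod W N : 'M[C]_n := \big[mulmx/1%:M]_(j < N) W j.

Lemma mxprod_telescope N W Q :
  (forall j, (j < N)%N -> Q j *m W j = Q j.+1) -> Q 0%N *m mxprod W N = Q N.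
Proof.
elim: N W Q => [|N IH] W Q HQ; first by rewrite /mxprod big_ord0 mulmx1.
rewrite /mxprod big_ord_recl mulmxA HQ //.
exact: (IH (W \o succn) (Q \o succn) (fun j jN => HQ j.+1 jN)).
Qed.

(** The entry of a product of matrices is the sum over paths from [a] to [b];
    [t] lists the interior vertices.  The defaults of [nth] supply the two end
    points: the [j]-th factor goes from the [j]-th entry of [a :: t] to the
    [j]-th entry of [t] followed by [b]. *)
Lemma mxprod_path N W (a b : 'I_n) :
  mxprod W N.+1 a b = \sum_(t : N.-tuple 'I_n)
    \prod_(j < N.+1) W j (nth a (a :: t) j) (nth b t j).
Proof.
elim: N W a => [|N IH] W a.
  rewrite /mxprod big_ord_recl big_ord0 mulmx1.
  rewrite (big_pred1 [tuple]) => [|t]; last by rewrite [t]tuple0; apply/esym/eqP.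
  by rewrite big_ord_recl big_ord0 mulr1.
rewrite /mxprod big_ord_recl mxE.
rewrite (reindex
  (fun p : 'I_n * N.-tuple 'I_n => [tuple of p.1 :: p.2])) /=; last first.
  exists (fun t => (thead t, [tuple of behead t])) => [[x t] _|t _].
    by congr pair; apply/val_inj.
  by rewrite -tuple_eta.
rewrite -(pair_bigA _ (fun x (t : N.-tuple 'I_n) =>
  \prod_(j < N.+2) W j (nth a [:: a, x & t] j) (nth b (x :: t) j))) /=.
apply: eq_bigr => x _.
transitivity (W 0%N a x * mxprod (W \o succn) N.+1 x b) => //.
rewrite IH mulr_sumr.
apply: eq_bigr => t _; rewrite [RHS]big_ord_recl /=; congr (_ * _).
apply: eq_bigr => j _; rewrite /=; congr (W _ _ _).
by apply: set_nth_default; rewrite /= size_tuple.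
Qed.

Lemma trace_closed_path N W : (0 < N)%N ->
  \sum_(t : N.-tuple 'I_n) \prod_(j < N) W j (tnth t j) (tnth t (ordS j)) =
  \tr (mxprod W N).
Proof.
case: N => // N _.
rewrite (reindex
  (fun p : 'I_n * N.-tuple 'I_n => [tuple of p.1 :: p.2])) /=; last first.
  exists (fun t => (thead t, [tuple of behead t])) => [[x t] _|t _].
    by congr pair; apply/val_inj.
  by rewrite -tuple_eta.
rewrite -(pair_bigA _ (fun x (t : N.-tuple 'I_n) =>
  \prod_(j < N.+1) W j (tnth [tuple of x :: t] j)
    (tnth [tuple of x :: t] (ordS j)))) /=.
apply: eq_bigr => x _; rewrite mxprod_path.
apply: eq_bigr => t _; apply: eq_bigr => j _; congr (W _ _ _).
  by rewrite (tnth_nth x).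
rewrite (tnth_nth x) /=; case: (ltngtP j N) => jN.
- by rewrite modn_small.
- by have := ltn_ord j; rewrite ltnS leqNgt jN.
by rewrite jN modnn /= nth_default // size_tuple.
Qed.

End Trace.

(** * Lifts of closed curves *)

Lemma smooth_derivable (R : realType) (f : R -> R) :
  smooth f -> forall t, derivable f t 1.
Proof. by move=> sf t; have := sf 0%N t. Qed.

Lemma smooth_continuous_derive1 (R : realType) (f : R -> R) :
  smooth f -> continuous (derive1 f).
Proof. by move=> sf; apply: derivable_continuous => t; have := sf 1%N t. Qed.

Lemma continuous_pair (S U V : topologicalType) (f : S -> U) (g : S -> V) :
  continuous f -> continuous g -> continuous (fun s => (f s, g s)).
Proof. by move=> cf cg s; apply: (cvg_pair (cf s) (cg s)). Qed.

Lemma continuous_integer_valued (R : realType) (f : R -> R) :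
  continuous f -> (forall t, exists n : int, f t = n%:~R) ->
  exists n : int, forall t, f t = n%:~R.
Proof.
move=> cf fint.
have ninc (g : R -> R) (s t : R) : continuous g ->
    (forall t, exists n : int, g t = n%:~R) -> s <= t -> ~ g s < g t.
  move=> cg gint st gst; have [a sa] := gint s; have [b tb] := gint t.
  have ab : (a < b)%R by rewrite -(ltr_int R) -sa -tb.
  have ab1 : g s + 1 <= g t by rewrite sa tb -[1]/(1%:~R) -intrD ler_int; lia.
  have [||z _ zE] := @IVT R g s t (g s + 1 / 2) st.
  - exact: continuous_subspaceT.
  - by rewrite ge_min le_max; apply/andP; split; apply/orP; [left|right]; lra.
  have [m mE] := gint z; have /andP[] : (a < m < a + 1)%R.
    by rewrite -!(ltr_int R) intrD -mE -sa zE mulr1z; lra.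
  lia.
have cst (s t : R) : s <= t -> f s = f t.
  move=> st; have [fst|fst|//] := ltgtP (f s) (f t).
    by case: (ninc f s t).
  case: (ninc (fun u => - f u) s t) => //; last by rewrite ltrN2.
    by move=> u; apply: cvgN; exact: cf.
  by move=> u; have [k kE] := fint u; exists (- k); rewrite mulrNz kE.
have [n n0] := fint 0; exists n => t; rewrite -n0.
by have [/cst|/ltW/cst] := leP t 0.
Qed.

Lemma quasi_periodic_int (R : realType) (x : R -> R) (a : R) :
  (forall t, x (t + 1) = x t + a) ->
  forall (n : int) t, x (t + n%:~R) = x t + n%:~R * a.
Proof.
move=> px n t.
have /(_ _ n t) := @periodic_int R (fun u => x u - (u - t) * a = x t).
rewrite addrAC subrr add0r => -[|_ H].
  by move=> u; rewrite px (_ : x u + a - _ = x u - (u - t) * a) //; ring.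
by rewrite -H ?subrK // mul0r subr0.
Qed.

Section Loop.
Context (R : realType) (T : topologicalType) (pr : R * R -> T).
Hypothesis hpr : torus_covering pr.
Context (x y : R -> R).
Hypothesis (cx : continuous x) (cy : continuous y).
Local Notation c := (fun t => pr (x t, y t)).

Lemma lift_continuous : continuous c.
Proof.
move=> t; apply: (@continuous_comp _ _ _ (fun t => (x t, y t)) pr);
  last exact: torus_continuous.
exact: continuous_pair.
Qed.

Lemma loop_periods : (forall t, c (t + 1) = c t) -> exists a b : int,
  (forall t, x (t + 1) = x t + a%:~R) /\ (forall t, y (t + 1) = y t + b%:~R).
Proof.
move=> c1.
have sh f : continuous f -> continuous (fun t : R => f (t + 1) - f t : R).
  move=> cf t; apply: cvgB; last exact: cf.
  apply: (@continuous_comp _ _ _ (fun t : R => t + 1) f); last exact: cf.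
  by apply: cvgD; [exact: cvg_id|exact: cvg_cst].
have per t : exists m n : int,
    x (t + 1) - x t = m%:~R /\ y (t + 1) - y t = n%:~R.
  have /esym/(torus_fibre hpr)[m [n /= [-> ->]]] := c1 t.
  by exists m, n; rewrite ![_ + _ - _]addrAC !subrr !add0r.
have [|a Ha] := continuous_integer_valued (sh x cx).
  by move=> t; have [m [n []]] := per t; exists m.
have [|b Hb] := continuous_integer_valued (sh y cy).
  by move=> t; have [m [n []]] := per t; exists n.
by exists a, b; split=> t; [rewrite -(Ha t)|rewrite -(Hb t)]; ring.
Qed.

(** If the lift is itself closed, it contracts linearly to the origin; the
    isotopy from [k] to the image of the lift is run through first. *)
Lemma contractible_nullhomotopic (k : R -> T) (phi : R * T -> T) :
  (forall t, x (t + 1) = x t) -> (forall t, y (t + 1) = y t) ->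
  continuous k -> (forall t, k (t + 1) = k t) -> continuous phi ->
  (forall p, phi (0, p) = p) -> (forall t, c t = phi (1, k t)) ->
  loop_nullhomotopic k.
Proof.
move=> x1 y1 ck k1 cphi phi0 cE.
pose f (z : R * R) := phi (2 * z.2, k z.1).
pose g (z : R * R) := pr ((2 - 2 * z.2) * x z.1, (2 - 2 * z.2) * y z.1).
have cf : continuous f.
  move=> z.
  apply: (@continuous_comp _ _ _ (fun z : R * R => (2 * z.2, k z.1)) phi);
    last exact: cphi.
  apply: continuous_pair => {}z.
    by apply: cvgM; [exact: cvg_cst|exact: cvg_snd].
  by apply: continuous_comp; [exact: cvg_fst|exact: ck].
have cg : continuous g.
  have lin : continuous (fun z : R * R => 2 - 2 * z.2).
    move=> z; apply: cvgB; first exact: cvg_cst.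
    by apply: cvgM; [exact: cvg_cst|exact: cvg_snd].
  move=> z; apply: (@continuous_comp _ _ _
    (fun z : R * R => ((2 - 2 * z.2) * x z.1, (2 - 2 * z.2) * y z.1)) pr);
    last exact: torus_continuous.
  apply: continuous_pair => {}z; apply: cvgM; try exact: lin.
    by apply: (@continuous_comp _ _ _ fst x); [exact: cvg_fst|exact: cx].
  by apply: (@continuous_comp _ _ _ fst y); [exact: cvg_fst|exact: cy].
pose h z := if z.2 <= 1 / 2 then f z else g z.
have fg z : z.2 = 1 / 2 -> f z = g z.
  move=> zE; rewrite /f /g zE (_ : 2 * (1 / 2) = 1 :> R); last by field.
  by rewrite -cE (_ : 2 - 1 = 1 :> R) ?mul1r //; ring.
exists h; split.
- move=> z W hW.
  have fW : h z = f z -> \forall z' \near z, W (f z').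
    by move=> hE; apply: cf; rewrite -hE.
  have gW : h z = g z -> \forall z' \near z, W (g z').
    by move=> hE; apply: cg; rewrite -hE.
  have [zlt|zgt|zE] := ltgtP z.2 (1 / 2).
  + have hE : h z = f z by rewrite /h ltW.
    have near_lt : \forall z' \near z, z'.2 < 1 / 2.
      exact: (cvgr_lt _ (@cvg_snd _ _ _ _ _)).
    have {}fW := fW hE; change (\forall z' \near z, W (h z')).
    by near=> z'; rewrite /h ltW; near: z'.
  + have hE : h z = g z by rewrite /h leNgt zgt.
    have near_gt : \forall z' \near z, 1 / 2 < z'.2.
      exact: (cvgr_gt _ (@cvg_snd _ _ _ _ _)).
    have {}gW := gW hE; change (\forall z' \near z, W (h z')).
    near=> z'; rewrite /h leNgt ifF; first by near: z'.
    by apply/negbTE; rewrite negbK; near: z'.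
  + have hE : h z = f z by rewrite /h zE lexx.
    have {}fW := fW hE; have {}gW := gW (etrans hE (fg _ zE)).
    change (\forall z' \near z, W (h z')).
    by near=> z'; rewrite /h; case: ifP => _; near: z'.
- by move=> t s; rewrite /h /f /g /= k1 x1 y1.
- by move=> t; rewrite /h /f /= divr_ge0 // mulr0 phi0.
- exists (pr (0, 0)) => t; rewrite /h /g /= ifF; last by apply/negbTE; rewrite -ltNge; lra.
  by rewrite mulr1 subrr !mul0r.
Unshelve. all: by end_near.
Qed.

End Loop.

(** * Simple closed diagrams *)

Section SimpleDiagram.
Context (R : realType) (T : topologicalType) (pr : R * R -> T).
Hypothesis hpr : torus_covering pr.
Context (D : framed_link pr 1).
Local Notation x := (lx D ord0).
Local Notation y := (ly D ord0).
Local Notation c := (shadow D ord0).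
Hypothesis Dinj : forall s t, c s = c t -> same_time s t.

Let hT : hausdorff_space T := torus_hausdorff hpr.

Let cx : continuous x.
Proof.
have [sx _ _] := link_smooth D ord0.
exact/derivable_continuous/smooth_derivable.
Qed.

Let cy : continuous y.
Proof.
have [_ sy _] := link_smooth D ord0.
exact/derivable_continuous/smooth_derivable.
Qed.

Let cc : continuous c. Proof. exact: (lift_continuous hpr cx cy). Qed.

Let c1 t : c (t + 1) = c t. Proof. exact: link_closed. Qed.

Lemma diagram_set_range : diagram_set D = range c.
Proof.
apply/seteqP; split=> p; first by move=> [i [t <-]]; rewrite (ord1 i); exists t.
by move=> [t _ <-]; exists ord0, t.
Qed.

Lemma not_crossing p : ~ is_crossing D p.
Proof.
move=> [i [s [j [t [sp tp]]]]]; rewrite (ord1 i) (ord1 j) in sp tp *; apply.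
by split=> //; apply: Dinj; rewrite sp.
Qed.

Lemma height_same s t : c s = c t -> lz D ord0 s = lz D ord0 t.
Proof.
move=> /Dinj[n ->]; apply/esym; move: n s.
have /(_ _ _)H := @periodic_int R.
move=> n s; have := H (fun u => lz D ord0 u = lz D ord0 s) _ n s.
by case=> [u|_ ->//]; rewrite height_closed.
Qed.

(** The part of the curve outside a short time interval around [t] is compact
    and misses the point, so near the point the diagram is the short arc alone;
    and near [(x t, y t)] the covering is injective, so that the short arc has
    there only its own lift. *)
Lemma near_diagram_local t e : 0 < e ->
  \forall q \near ((x t, y t) : R * R), diagram_set D (pr q) ->
    exists2 u, `|u - t| < e & q = (x u, y u).
Proof.
move=> e0; pose g u : R * R := (x u, y u).
have cg : continuous g by exact: continuous_pair.
have /nbhs_ballP[d /= d0 Hd] : \forall u \near t, ball (g t) (1 / 4 : R) (g u).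
  by apply: (cg t); apply: nbhsx_ballx; lra.
pose k := Num.min (Num.min e d) 1 / 2.
have [k0 ke kd k1] : [/\ 0 < k, k < e, k < d & k <= 1 / 2].
  have m0 : 0 < Num.min (Num.min e d) 1 by rewrite !lt_min e0 d0 ltr01.
  have m1 : Num.min (Num.min e d) 1 <= 1 by rewrite ge_min lexx orbT.
  have me : Num.min (Num.min e d) 1 <= e by rewrite !ge_min lexx.
  have md : Num.min (Num.min e d) 1 <= d by rewrite !ge_min lexx orbT.
  by rewrite /k; move: (Num.min _ _) m0 m1 me md => m *; split; lra.
have offK : nbhs (pr (g t)) (~` (c @` `[t + k, t + 1 - k])).
  apply: open_nbhs_nbhs; split.
    exact/closed_openC/(loop_image_closed hT cc).
  move=> [w]; rewrite /= in_itv /= => /andP[w1 w2] cw.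
  by have := loop_inj Dinj _ cw; rewrite ltr_norml; lra.
have prK : \forall q \near g t, ~ (c @` `[t + k, t + 1 - k]) (pr q).
  exact: (torus_continuous hpr offK).
have nearg : \forall q \near g t, ball (g t) (1 / 4 : R) q.
  by apply: nbhsx_ballx; lra.
change (\forall q \near g t, diagram_set D (pr q) ->
    exists2 u, `|u - t| < e & q = (x u, y u)).
near=> q; rewrite diagram_set_range => -[v _ vq].
have [u /andP[u1 u2] uq] := loop_shift c1 (t - k) v.
have qK : ~ (c @` `[t + k, t + 1 - k]) (pr q) by near: q.
have utk : u < t + k.
  rewrite ltNge; apply/negP => tku; apply: qK; exists u; last by rewrite uq.
  by rewrite /= in_itv /= tku; lra.
have ut : `|u - t| <= k by rewrite ler_norml; lra.
exists u; first exact: le_lt_trans ke.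
have [gu1 gu2] : ball (g t) (1 / 4 : R) (g u).
  by apply: Hd; rewrite /ball /= distrC; exact: le_lt_trans kd.
have [gq1 gq2] : ball (g t) (1 / 4 : R) q by near: q.
move: gu1 gu2 gq1 gq2; rewrite /ball /= => gu1 gu2 gq1 gq2.
(* Both [q] and [g u] are within 1/4 of [g t], so their difference, which is
   integral, vanishes. *)
have : pr (x u, y u) = pr q by rewrite -vq -uq.
move=> /(torus_fibre hpr)[m [n /= qE]].
move: gq1 gq2; rewrite qE /= => gq1 gq2.
have -> : m = 0.
  apply: (@eq0_of_norm_lt1 R).
  by move: gu1 gq1; rewrite !ltr_norml; lra.
have -> : n = 0.
  apply: (@eq0_of_norm_lt1 R).
  by move: gu2 gq2; rewrite !ltr_norml; lra.
by rewrite !addr0.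
Unshelve. all: by end_near.
Qed.

(** The comparison [rel] of the two heights is allowed to depend on their
    difference only, because the lift [q] of the point may be a translate of
    [(x t, y t)]. *)
Lemma local_extremum (rel : R -> R -> Prop) t :
  (forall u v d, rel (u + d) (v + d) <-> rel u v) ->
  (diagram_set D (c t) /\ exists q : R * R, pr q = c t /\
     \forall q' \near q, diagram_set D (pr q') -> rel q'.2 q.2) <->
  \forall u \near t, rel (y u) (y t).
Proof.
move=> shift; split=> [[_ [q [qt Hq]]]|H].
  have /(torus_fibre hpr)[m [n /= qE]] : pr (x t, y t) = pr q by rewrite qt.
  pose g u : R * R := (x u + m%:~R, y u + n%:~R).
  have cg : continuous g.
    apply: continuous_pair => u; apply: cvgD; try exact: cvg_cst.
      exact: cx.
    exact: cy.
  have {}Hq : nbhs (g t) [set q' | diagram_set D (pr q') -> rel q'.2 q.2].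
    by rewrite /g -qE.
  have : \forall u \near t, diagram_set D (pr (g u)) -> rel (g u).2 q.2.
    exact: cg t _ Hq.
  apply: filterS => u; rewrite qE /= shift; apply.
  rewrite diagram_set_range; exists u => //.
  by apply/(torus_fibre hpr); exists m, n.
split; first by rewrite diagram_set_range; exists t.
exists (x t, y t); split=> //; move: H => /nbhs_ballP[e /= e0 He].
apply: filterS (near_diagram_local t e0) => q Hq /Hq[u ut ->] /=.
by apply: He; rewrite /ball /= distrC.
Qed.

Lemma cap_local_max t : is_cap D (c t) <-> \forall u \near t, y u <= y t.
Proof.
by apply: (local_extremum (rel := fun u v => u <= v)) => u v d; rewrite lerD2r.
Qed.

Lemma cup_local_min t : is_cup D (c t) <-> \forall u \near t, y t <= y u.
Proof.
by apply: (local_extremum (rel := fun u v => v <= u)) => u v d; rewrite lerD2r.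
Qed.

Lemma critical_time t : critical D (c t) <->
  (\forall u \near t, y u <= y t) \/ (\forall u \near t, y t <= y u).
Proof.
rewrite -cap_local_max -cup_local_min; split; last by case; [constructor 2|constructor 3].
by case=> [/not_crossing//||]; [left|right].
Qed.

Definition arc s t : set T := c @` `]s, t[.

Definition gap s t :=
  [/\ s < t, t <= s + 1, critical D (c s), critical D (c t) &
  forall u, s < u < t -> ~ critical D (c u)].

Let cint := loop_int c1.

Lemma gap_shift (n : int) s t : gap s t -> gap (s + n%:~R) (t + n%:~R).
Proof.
case=> st t1 Cs Ct nC; split; rewrite ?cint ?ltrD2r //; first by lra.
move=> u us; rewrite -(cint (- n) u); apply: nC; rewrite mulrNz; lra.
Qed.

Lemma arc_shift (n : int) s t : arc (s + n%:~R) (t + n%:~R) = arc s t.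
Proof.
apply/seteqP; split=> p [u]; rewrite /= in_itv /= => ust <-.
  exists (u + (- n)%:~R); last exact: cint.
  by rewrite /= in_itv /= mulrNz; lra.
by exists (u + n%:~R); [rewrite /= in_itv /=; lra|exact: cint].
Qed.

Lemma gap_component s t u : gap s t -> s < u < t ->
  connected_component (diagram_set D `\` critical D) (c u) = arc s t.
Proof.
move=> [st t1 Cs Ct nC] su; rewrite diagram_set_range.
exact: (arc_component hT cc c1 Dinj).
Qed.

Lemma arc_of_gap i s t : gap s t -> arc_of D i (arc s t).
Proof.
move=> g; have [st _ _ _ nC] := g; rewrite (ord1 i); exists ((s + t) / 2).
have ms : s < (s + t) / 2 < t by lra.
by split; [exact: nC|rewrite (gap_component g ms)].
Qed.

Lemma arc_of_eq i B s t u : gap s t -> arc_of D i B -> s < u < t -> B (c u) ->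
  B = arc s t.
Proof.
move=> g [v [_ BE]] su; rewrite BE => /same_connected_component ->.
exact: gap_component.
Qed.

Lemma label_before_gap (sigma : set T -> nat) i s t k : gap s t ->
  label_before D sigma i t k <-> sigma (arc s t) = k.
Proof.
move=> g; have [st _ _ _ _] := g; rewrite (ord1 i).
have in_gap : \forall u \near t^'-, s < u < t.
  near=> u; apply/andP; split; near: u.
    exact: nbhs_left_gt.
  exact: nbhs_left_lt.
split=> [[B [aB nB <-]]|sk].
  near t^'- => u; congr sigma; apply/esym/(arc_of_eq (u := u) g aB).
    by near: u.
  by near: u.
exists (arc s t); split=> //; first exact: arc_of_gap.
by apply: filterS in_gap => u su; exists u => //; rewrite /= in_itv.
Unshelve. all: by end_near.
Qed.

Lemma label_after_gap (sigma : set T -> nat) i s t k : gap s t ->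
  label_after D sigma i s k <-> sigma (arc s t) = k.
Proof.
move=> g; have [st _ _ _ _] := g; rewrite (ord1 i).
have in_gap : \forall u \near s^'+, s < u < t.
  near=> u; apply/andP; split; near: u.
    exact: nbhs_right_gt.
  exact: nbhs_right_lt.
split=> [[B [aB nB <-]]|sk].
  near s^'+ => u; congr sigma; apply/esym/(arc_of_eq (u := u) g aB).
    by near: u.
  by near: u.
exists (arc s t); split=> //; first exact: arc_of_gap.
by apply: filterS in_gap => u su; exists u => //; rewrite /= in_itv.
Unshelve. all: by end_near.
Qed.

Lemma gap_no_extremum s t u : gap s t -> s < u < t ->
  ~ (\forall v \near u, y v <= y u) /\ ~ (\forall v \near u, y u <= y v).
Proof.
move=> [_ _ _ _ nC] /nC; rewrite critical_time => nu.
by split=> ?; apply: nu; [left|right].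
Qed.

(** The height would be constant near a point that is both a cap and a cup, but
    it is strictly monotone on the arc before it. *)
Lemma cap_not_cup s t : gap s t -> is_cap D (c t) -> ~ is_cup D (c t).
Proof.
move=> g; have [st _ _ _ _] := g.
rewrite cap_local_max cup_local_min.
move=> /near_one_sided[ml _] /near_one_sided[nl _].
near t^'- => u.
have yu : y u = y t by apply/eqP; rewrite eq_le; apply/andP; split; near: u.
have su : s < u by near: u; exact: nbhs_left_gt.
have ut : u < t by near: u; exact: nbhs_left_lt.
have [i|d] := strict_monotone_between cy (fun v => @gap_no_extremum s t v g).
  by have := i u t (ltW su) ut (lexx _); rewrite yu ltxx.
by have := d u t (ltW su) ut (lexx _); rewrite yu ltxx.
Unshelve. all: by end_near.
Qed.

Section Weight.
Context (C : fieldType) (A : algType C) (H : quasitriangular_hopf A).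
Context (mu muV : A) (V : based_module A) (hV : is_module V).

(** The four local operators at extrema have the same matrix as the action of an
    element of the algebra; a single relation lets caps and cups of both
    directions be treated alike. *)
Inductive turn_element (t : R) : A -> Prop :=
| Turn_lr of is_cap D (c t) \/ is_cup D (c t) & 0 < derive1 x t :
    turn_element t 1
| Turn_cap_rl of is_cap D (c t) & derive1 x t < 0 : turn_element t mu
| Turn_cup_rl of is_cup D (c t) & derive1 x t < 0 : turn_element t muV.

(** The weight refers to any time at which the curve is at the point; these are
    the translates [s + n], where labels and direction are those at [s]. *)
Lemma weight_turn r s t a (sigma : set T -> nat) (k l : 'I_(msize V)) :
  gap r s -> gap s t -> turn_element s a ->
  sigma (arc r s) = k -> sigma (arc s t) = l ->
  weight H mu muV D (fun=> V) sigma (c s) = action_matrix V a k l.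
Proof.
move=> grs gst ta sk sl.
have lb i n (k' : 'I_(msize V)) :
    label_before D sigma i (s + n%:~R) k' -> k' = k.
  move/(label_before_gap _ _ _ (gap_shift n grs)).
  by rewrite arc_shift sk => /val_inj.
have la i n (l' : 'I_(msize V)) :
    label_after D sigma i (s + n%:~R) l' -> l' = l.
  move/(label_after_gap _ _ _ (gap_shift n gst)).
  by rewrite arc_shift sl => /val_inj.
have lb0 : label_before D sigma ord0 s k by apply/(label_before_gap _ _ _ grs).
have la0 : label_after D sigma ord0 s l by apply/(label_after_gap _ _ _ gst).
have x' n : derive1 x (s + n%:~R) = derive1 x s.
  have [p [q [xp _]]] := loop_periods hpr cx cy c1.
  have /(_ _ n s) := @periodic_int R (fun u => derive1 x u = derive1 x s).
  by case=> [u|_ ->//]; rewrite (derive1_quasi_periodic xp).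
have capcup : is_cap D (c s) -> is_cup D (c s) -> False.
  exact: (cap_not_cup grs).
apply: xget_unique.
  case: ta => [[cap|cup] xs|cap xs|cup xs].
  - rewrite -(cap_lrE H hV).
    exact: (Weight_cap_lr H mu muV (V := fun=> V) (i := ord0) (t := s)).
  - rewrite -(cup_lrE H hV).
    exact: (Weight_cup_lr H mu muV (V := fun=> V) (i := ord0) (t := s)).
  - rewrite -(cap_rlE H).
    exact: (Weight_cap_rl H mu muV (V := fun=> V) (i := ord0) (t := s)).
  - rewrite -(cup_rlE H hV).
    exact: (Weight_cup_rl H mu muV (V := fun=> V) (i := ord0) (t := s)).
have nocr i u j v : shadow D i u = c s -> shadow D j v = c s ->
    lz D j v < lz D i u -> False.
  rewrite (ord1 i) (ord1 j) => us vs.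
  by rewrite (height_same (etrans us (esym vs))) ltxx.
have time i u : shadow D i u = c s -> exists n : int, u = s + n%:~R.
  by rewrite (ord1 i) => /esym/Dinj.
move=> w; case.
- move=> i u k' l' cap us xu.
  have [n uE] := time i u us; rewrite uE (ord1 i) x' in xu *.
  have -> : a = 1.
    by case: ta => [//|_ xs|cup]; [rewrite ltNge ltW in xu|case: (capcup)].
  by move=> /lb -> /la ->; exact: cap_lrE.
- move=> i u k' l' cap us xu.
  have [n uE] := time i u us; rewrite uE (ord1 i) x' in xu *.
  have -> : a = mu.
    by case: ta => [_ xs|//|cup]; [rewrite ltNge ltW in xu|case: (capcup)].
  by move=> /lb -> /la ->; exact: cap_rlE.
- move=> i u k' l' cup us xu.
  have [n uE] := time i u us; rewrite uE (ord1 i) x' in xu *.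
  have -> : a = 1.
    by case: ta => [//|cap|_ xs]; [case: (capcup)|rewrite ltNge ltW in xu].
  by move=> /lb -> /la ->; exact: cup_lrE.
- move=> i u k' l' cup us xu.
  have [n uE] := time i u us; rewrite uE (ord1 i) x' in xu *.
  have -> : a = muV.
    by case: ta => [_ xs|cap|//]; [rewrite ltNge ltW in xu|case: (capcup)].
  by move=> /lb -> /la ->; exact: cup_rlE.
- by move=> i u j v O U k1 k1' l1 l1' us vs /(nocr _ _ _ _ us vs).
- by move=> i u j v O U k1 k1' l1 l1' us vs /(nocr _ _ _ _ us vs).
Qed.

End Weight.
End SimpleDiagram.

(** * The state sum of an essential simple closed diagram *)

Lemma fsbig_fintype (S : Type) (idx : S) (op : Monoid.com_law idx) (I : finType)
    (F : I -> S) :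
  \big[op/idx]_(i \in [set: I]) F i = \big[op/idx]_i F i.
Proof.
rewrite [RHS]fsbig_seq ?index_enum_uniq //; apply: eq_fsbigl.
by apply/seteqP; split=> i //= _; exact: mem_index_enum.
Qed.

Section StateSum.
Context (R : realType) (T : topologicalType) (pr : R * R -> T).
Context (D : framed_link pr 1).
Context (C : fieldType) (A : algType C) (V : based_module A).
Context (N : nat) (B : 'I_N -> set T).
Hypothesis Binj : injective B.
Hypothesis arcE : forall i B', arc_of D i B' <-> exists j, B' = B j.
Local Notation n := (msize V).

Definition state_of (t : N.-tuple 'I_n) (B' : set T) : nat :=
  if [pick j | `[< B' = B j >]] is Some j then tnth t j else 0%N.

Lemma state_ofE t j : state_of t (B j) = tnth t j.
Proof.
rewrite /state_of; case: pickP => [k /asboolP/Binj -> //|/(_ j)].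
by move/asboolP.
Qed.

Lemma states_bij : set_bij [set: N.-tuple 'I_n] (states D (fun=> V)) state_of.
Proof.
split.
- move=> t _; split=> [i B' /arcE[j ->]|B' nB']; first by rewrite state_ofE.
  rewrite /state_of; case: pickP => // j /asboolP Bj.
  by case: (nB' ord0); apply/arcE; exists j.
- move=> t t' _ _ tt'; apply: eq_from_tnth => j; apply: ord_inj.
  by rewrite -!state_ofE tt'.
- move=> sigma [s1 s2].
  have sB j : (sigma (B j) < n)%N by apply: (s1 ord0); apply/arcE; exists j.
  exists [tuple Ordinal (sB j) | j < N] => //; apply/funext => B'.
  have [[j ->]|nB] := pselect (exists j, B' = B j).
    by rewrite state_ofE tnth_mktuple.
  rewrite s2; last by move=> i /arcE.
  rewrite /state_of; case: pickP => // j /asboolP Bj.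
  by case: nB; exists j.
Qed.

Lemma sum_states (F : (set T -> nat) -> C) :
  \sum_(sigma \in states D (fun=> V)) F sigma =
  \sum_(t : N.-tuple 'I_n) F (state_of t).
Proof. by rewrite (reindex_fsbig _ _ _ _ states_bij) fsbig_fintype. Qed.

End StateSum.

Section Knot.
Context (R : realType) (T : topologicalType) (pr : R * R -> T).
Hypothesis hpr : torus_covering pr.
Context (D : framed_link pr 1).
Local Notation x := (lx D ord0).
Local Notation y := (ly D ord0).
Local Notation c := (shadow D ord0).
Hypothesis hD : torus_diagram D.
Hypothesis Dinj : forall s t, c s = c t -> same_time s t.
Context (th : R -> R).
Hypothesis cth : continuous th.
Hypothesis th1 : forall t, th (t + 1) = th t.
Hypothesis thE : forall t, exists2 r, 0 < r &
  derive1 x t = r * cos (th t) /\ derive1 y t = r * sin (th t).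
Context (C : fieldType) (A : algType C) (H : quasitriangular_hopf A).
Context (mu muV : A) (V : based_module A) (hV : is_module V).
Hypothesis muK : mu * muV = 1.
Local Notation n := (msize V).

Let c1 t : c (t + 1) = c t. Proof. exact: link_closed. Qed.

Lemma critical_on_diagram p : critical D p -> exists t, p = c t.
Proof.
case=> [/(not_crossing Dinj) //|[+ _]|[+ _]];
  by rewrite diagram_set_range => -[t _ <-]; exists t.
Qed.

(** Without critical points the whole diagram is a single arc. *)
Lemma Phi_no_critical : (forall t, ~ critical D (c t)) ->
  Phi H mu muV D (fun=> V) = n%:R.
Proof.
move=> nC.
have C0 : critical D = set0.
  apply/seteqP; split=> p // /[dup] + /critical_on_diagram[t tE].
  by rewrite tE => /nC.
have comp t :
    connected_component (diagram_set D `\` critical D) (c t) = range c.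
  rewrite diagram_set_range; apply: circle_component => //.
  have [sx sy _] := link_smooth D ord0.
  by apply: (lift_continuous hpr); exact/derivable_continuous/smooth_derivable.
have arcE i B' : arc_of D i B' <-> exists j : 'I_1, B' = range c.
  rewrite (ord1 i); split=> [[t [_ ->]]|[_ ->]]; first by exists ord0; exact: comp.
  by exists 0; split; rewrite ?comp.
rewrite /Phi C0 (@sum_states _ _ _ _ _ _ _ 1 (fun=> range c)) //; last first.
  by move=> i j _; rewrite (ord1 i) (ord1 j).
under eq_bigr do rewrite fsbig_set0.
by rewrite big_const iter_addr_0 card_tuple card_ord expn1.
Qed.

(** The index [j] of an arc is that of the critical time [tt j] at its beginning.
    The factor of index [j] in the product belongs to the critical time
    [tt j.+1] at its end, where arc [j] is followed by arc [j + 1] modulo [N]. *)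
Lemma Phi_critical t0 : critical D (c t0) -> Phi H mu muV D (fun=> V) = n%:R.
Proof.
move=> Ct0.
have [sx sy _] := link_smooth D ord0.
have cc : continuous c.
  by apply: (lift_continuous hpr); exact/derivable_continuous/smooth_derivable.
have iso := critical_times_isolated cc Dinj (diagram_isolated hD).
have per t : critical D (c (t + 1)) <-> critical D (c t) by rewrite c1.
have [N [tt [[N0 Ctt ltt] nC ttD find]]] :=
  @periodic_discrete_enumeration R (fun t => critical D (c t)) t0 Ct0 per iso.
have ttmono i j : (i < j)%N -> tt i < tt j.
  apply: (@homo_ltn _ tt (fun u v : R => u < v)) => // ? ? ?.
  exact: lt_trans.
have ttle i j : (i <= j)%N -> tt i <= tt j.
  by rewrite leq_eqVlt => /predU1P[->//|/ttmono/ltW].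
have ttN : tt N = tt 0%N + 1 by rewrite -ttD add0n.
have g j : gap D (tt j) (tt j.+1).
  split=> //; last exact: nC.
  by rewrite -ttD; apply: ttle; rewrite -addn1 leq_add2l.
have /choice[e He] : forall j, exists k, arc_index th y (tt j) (tt j.+1) k.
  move=> j; apply: arc_index_exists => //.
  - exact: smooth_derivable.
  - by move=> u; have [r r0 [_ yE]] := thE u; exists r.
  - by move=> u; exact: (gap_no_extremum hpr Dinj).
(* The arcs [N] and 0 are the same arc one period apart, and the angle is
   periodic. *)
have eN : e N = e 0%N.
  apply: (@arc_index_uniq _ th y (tt 0%N) (tt 1%N)) => //.
  have [a [b [_ yp]]] := loop_periods hpr
    (derivable_continuous (smooth_derivable sx))
    (derivable_continuous (smooth_derivable sy)) c1.
  have tt1 : tt N.+1 = tt 1%N + 1 by rewrite -ttD add1n.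
  have := He N; rewrite tt1 ttN.
  case=> -[m h]; [left|right]; split.
  - move=> u v u0 uv v1; have : y (u + 1) < y (v + 1) by apply: m; lra.
    by rewrite !yp ltrD2r.
  - by move=> u u0; rewrite -th1; apply: h; lra.
  - move=> u v u0 uv v1; have : y (v + 1) < y (u + 1) by apply: m; lra.
    by rewrite !yp ltrD2r.
  - by move=> u u0; rewrite -th1; apply: h; lra.
pose M := action_matrix V mu; pose M' := action_matrix V muV.
have MM' : M *m M' = 1%:M by rewrite -(action_matrixM hV) muK action_matrix1.
pose Q j := mxpow M M' (e j).
have /choice[a Ha] : forall j, exists a, turn_element D mu muV (tt j.+1) a /\
    Q j *m action_matrix V a = Q j.+1.
  move=> j; have [r r0 [xE yE]] := thE (tt j.+1).
  have cos0 : sin (th (tt j.+1)) = 0 -> cos (th (tt j.+1)) != 0.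
    move=> s0; apply/eqP => k0; have := cos2Dsin2 (th (tt j.+1)).
    by rewrite s0 k0 expr0n addr0 => /esym/eqP; rewrite oner_eq0.
  have [cmax|cmin] := (critical_time hpr Dinj _).1 (Ctt j.+1).
  - have [s0 [ep en]] := turn_at_max (ltt _) (ltt _) (He j) (He j.+1) cmax.
    have := cos0 s0; rewrite neq_lt => /orP[cn|cp].
      exists mu; split; last by rewrite /Q (en cn) mxpowS.
      apply: Turn_cap_rl; first exact/(cap_local_max hpr Dinj).
      by rewrite xE pmulr_rlt0.
    exists 1; split; last by rewrite /Q (ep cp) action_matrix1 // mulmx1.
    apply: Turn_lr; first by left; exact/(cap_local_max hpr Dinj).
    by rewrite xE pmulr_rgt0.
  - have [s0 [ep en]] := turn_at_min (ltt _) (ltt _) (He j) (He j.+1) cmin.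
    have := cos0 s0; rewrite neq_lt => /orP[cn|cp].
      exists muV; split; last by rewrite /Q (en cn) mxpowB.
      apply: Turn_cup_rl; first exact/(cup_local_min hpr Dinj).
      by rewrite xE pmulr_rlt0.
    exists 1; split; last by rewrite /Q (ep cp) action_matrix1 // mulmx1.
    apply: Turn_lr; first by right; exact/(cup_local_min hpr Dinj).
    by rewrite xE pmulr_rgt0.
pose B (j : 'I_N) := arc D (tt j) (tt j.+1).
have Bwin (j : 'I_N) u : tt j < u -> u <= tt j.+1 -> tt 0%N < u <= tt 0%N + 1.
  move=> ju uj; rewrite (le_lt_trans (ttle _ _ (leq0n j)) ju) /= -ttN.
  by apply: le_trans uj _; exact: ttle.
(* The intervals of one period are disjoint, and the curve is injective on a
   half-open interval of length 1. *)
have same_window (i j : 'I_N) u v : tt i < u -> u <= tt i.+1 ->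
    tt j < v -> v <= tt j.+1 -> c u = c v -> i = j.
  move=> iu ui jv vj uv; have /andP[u0 u1] := Bwin _ _ iu ui.
  have /andP[v0 v1] := Bwin _ _ jv vj.
  have uvE : u = v by apply: (loop_inj Dinj _ uv); rewrite ltr_norml; lra.
  apply: ord_inj; case: (ltngtP i j) => // [/ttle ij|/ttle ji].
    have : u <= tt j by exact: le_trans ui ij.
    by rewrite leNgt uvE jv.
  have : v <= tt i by exact: le_trans vj ji.
  by rewrite leNgt -uvE iu.
have Binj : injective B.
  move=> i j Bij.
  have mi : tt i < (tt i + tt i.+1) / 2 < tt i.+1 by have := ltt i; lra.
  have : B i (c ((tt i + tt i.+1) / 2)).
    by exists ((tt i + tt i.+1) / 2); rewrite //= in_itv.
  rewrite Bij => -[v]; rewrite /= in_itv /= => /andP[v1 v2] vE.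
  have /andP[m1 m2] := mi.
  exact: (same_window i j _ v m1 (ltW m2) v1 (ltW v2) (esym vE)).
have arcE i B' : arc_of D i B' <-> exists j, B' = B j.
  split=> [[t [nt ->]]|[j ->]]; last exact: (arc_of_gap hpr Dinj).
  rewrite (ord1 i) in nt *.
  have [j jN [m /andP[jt tj]]] := find t; exists (Ordinal jN).
  have tm : c (t + m%:~R) = c t by exact: loop_int.
  rewrite -tm in nt *; apply: (gap_component hpr Dinj (g j)).
  rewrite jt lt_neqAle tj andbT /=; apply/eqP => tE; apply: nt.
  by rewrite tE; exact: Ctt.
have Cset : critical D = (fun j : 'I_N => c (tt j.+1)) @` setT.
  apply/seteqP; split=> [p Cp|p [j _ <-]]; last exact: Ctt.
  have [t tE] := critical_on_diagram Cp.
  have [j jN [m /andP[jt tj]]] := find t; exists (Ordinal jN) => //=.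
  have tm : c (t + m%:~R) = c t by exact: loop_int.
  rewrite tE -tm; congr (c _); apply/eqP.
  rewrite eq_le tj andbT leNgt; apply/negP => lt.
  by apply: (nC j (t + m%:~R)); [rewrite jt|rewrite tm -tE].
have Cinj : set_inj [set: 'I_N] (fun j : 'I_N => c (tt j.+1)).
  by move=> i j _ _ ij; apply: (same_window i j _ _ _ _ _ _ ij).
rewrite /Phi (sum_states V Binj arcE).
pose W j := action_matrix V (a j).
have WE (t : N.-tuple 'I_n) :
    \big[*%R/1]_(p \in critical D)
      weight H mu muV D (fun=> V) (state_of B t) p =
    \prod_(j < N) W j (tnth t j) (tnth t (ordS j)).
  rewrite Cset (fsbig_image _ _ _ Cinj) fsbig_fintype; apply: eq_bigr => j _.
  apply: (weight_turn hpr Dinj H hV (g j) (g j.+1) (Ha j).1).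
    exact: (state_ofE Binj t j).
  suff <- : B (ordS j) = arc D (tt j.+1) (tt j.+2) by exact: (state_ofE Binj).
  rewrite /B /=; have := ltn_ord j; rewrite leq_eqVlt => /predU1P[jN|jN].
    rewrite jN modnn -(arc_shift D 1) !mulr1z.
    by rewrite -!ttD add0n add1n.
  by rewrite modn_small.
under eq_bigr do rewrite WE.
rewrite trace_closed_path //.
have QW : Q 0%N *m mxprod W N = Q N.
  by apply: mxprod_telescope => j _; exact: (Ha j).2.
have QN : Q N = Q 0%N by rewrite /Q eN.
have -> : mxprod W N = 1%:M.
  apply: (can_inj (mulKmx (mxpow_unit MM' (e 0%N)))).
  by rewrite -/(Q 0%N) QW QN mulmx1.
exact: mxtrace1.
Qed.

End Knot.

Theorem proposition3p8 (R : realType)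
  (T : topologicalType) (pi : R * R -> T) (hpi : torus_covering pi)
  (A : algType (R[i])%C) (H : quasitriangular_hopf A)
  (mu muV : A) (hmu : good_unit H mu muV)
  (K : framed_link pi 1) (hframe : parallel_framing K)
  (hK : essential_simple_closed (shadow K ord0))
  (V : based_module A) (hV : is_module V)
  (n : nat) (hn : \dim (fullv : {vspace mcarrier V}) = n)
  (D : framed_link pi 1) (hD : torus_diagram_of K D)
  (hDframe : parallel_framing D) :
  Phi H mu muV D (fun=> V) = n%:R.
Proof.
have nE : msize V = n by rewrite -hn (size_basis (mbasisP hV)).
rewrite -{}nE {hn n}.
have [tD [phi [cphi phibij phi0 phi1]]] := hD.
have [ck k1 kinj ess] := hK.
have [sx sy _] := link_smooth D ord0.
have dx := smooth_derivable sx; have dy := smooth_derivable sy.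
have cx := derivable_continuous dx; have cy := derivable_continuous dy.
have Dinj s t : shadow D ord0 s = shadow D ord0 t -> same_time s t.
  have I1 : 0 <= (1 : R) <= 1 by rewrite ler01 lexx.
  have inj1 := bij_inj (phibij 1 I1).
  by rewrite (phi1 _ s).1 (phi1 _ t).1 => /inj1; exact: kinj.
have [a [b [xp yp]]] := loop_periods hpi cx cy (link_closed D ord0).
have ab : (a%:~R, b%:~R) <> (0, 0) :> R * R.
  move=> [a0 b0]; apply: ess.
  apply: (contractible_nullhomotopic hpi cx cy _ _ ck k1 cphi) => //.
  - by move=> t; rewrite xp a0 addr0.
  - by move=> t; rewrite yp b0 addr0.
  - by move=> t; exact: (phi1 ord0 t).1.
have [th cth [th1 thE]] :
    has_periodic_angle (derive1 (lx D ord0)) (derive1 (ly D ord0)).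
  apply: (velocity_has_periodic_angle dx dy _ _ xp yp ab).
  - exact: smooth_continuous_derive1.
  - exact: smooth_continuous_derive1.
  - move=> s t xst yst.
    have [m tE] : same_time s t by apply: Dinj; rewrite /shadow xst yst.
    move: xst yst; rewrite tE (quasi_periodic_int xp) (quasi_periodic_int yp).
    move=> xst yst.
    have /eqP : m%:~R * a%:~R = 0 :> R by lra.
    rewrite mulf_eq0 => /orP[/eqP->|/eqP a0]; first by rewrite addr0.
    have /eqP : m%:~R * b%:~R = 0 :> R by lra.
    rewrite mulf_eq0 => /orP[/eqP->|/eqP b0]; first by rewrite addr0.
    by case: ab; rewrite a0 b0.
  - by move=> t; exact: diagram_immersed.
have muK := good_unit_mulV hmu.
have [[t0 Ct0]|/forallNP nC] :=
  pselect (exists t, critical D (shadow D ord0 t)).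
  exact: (Phi_critical hpi tD Dinj cth th1 thE H hV muK Ct0).
exact: Phi_no_critical.
Qed.
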